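(* Let $n\ge 1$ and let $\mathcal{P},\mathcal{Q}$ be probability distributions on $\{0,1\}^n$. Let $\eta\in(0,1]$, $\varepsilon\in[0,\eta/11.6)$ and $\delta\in(0,1/2]$. There is a randomized algorithm ($\mathsf{Barbarik3}$) which, given $\eta,\varepsilon,\delta$, $\mathsf{DUAL}$ oracle access to $\mathcal{P}$, and $\mathsf{PCOND}$ and $\mathsf{SAMP}$ oracle access to $\mathcal{Q}$, satisfies: with probability at least $1-\delta$ it returns (i) $\mathsf{Accept}$ if $d_{\infty}(\mathcal{P},\mathcal{Q})\le\varepsilon$, and (ii) $\mathsf{Reject}$ if $d_{TV}(\mathcal{P},\mathcal{Q})>\eta$. The algorithm makes a total of $$\tilde{O}\left(\frac{\sqrt{n}\,\log n}{\eta^3(\eta-11.6\varepsilon)}+\frac{n}{\eta^2}\right)$$ oracle queries, where $\tilde{O}$ hides factors polylogarithmic in $1/\varepsilon$, $1/\eta$ and $1/\delta$.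
   Context: Oracles: $\mathsf{SAMP}$ access to a distribution $\mathcal{D}$ returns an independent sample $x\sim\mathcal{D}$. $\mathsf{DUAL}$ access to $\mathcal{D}$ allows both drawing independent samples from $\mathcal{D}$ and querying the exact value $\mathcal{D}(x)$ for any $x\in\{0,1\}^n$. $\mathsf{PCOND}$ (pair-conditional) access to $\mathcal{D}$ takes as input a set $S\subseteq\{0,1\}^n$ with $|S|=2$ and $\mathcal{D}(S)>0$ and returns an independent sample $x\in S$ with probability $\mathcal{D}(x)/\mathcal{D}(S)$. Each oracle call counts as one query. Distances: $d_{TV}(\mathcal{D}_1,\mathcal{D}_2)=\frac12\sum_{x\in\{0,1\}^n}|\mathcal{D}_1(x)-\mathcal{D}_2(x)|$, and $d_{\infty}(\mathcal{D}_1,\mathcal{D}_2)=\max_{x\in\{0,1\}^n}|\mathcal{D}_2(x)/\mathcal{D}_1(x)-1|$ (multiplicative distance of $\mathcal{D}_2$ from $\mathcal{D}_1$). *)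

(* Defs.v *)
From HB Require Import structures.
From mathcomp Require Import all_boot all_order all_algebra.
From mathcomp Require Import all_classical all_reals ereal exp.

Set Implicit Arguments.
Unset Strict Implicit.
Unset Printing Implicit Defensive.

Import Order.TTheory GRing.Theory Num.Theory.
Local Open Scope ring_scope.

Definition cube (n : nat) : finType := n.-tuple bool.

Record distr (R : realType) (n : nat) := Distr {
  pmf :> cube n -> R;
  pmf_ge0 : forall x, 0 <= pmf x;
  pmf_sum1 : \sum_(x : cube n) pmf x = 1
}.

Definition mass (R : realType) (n : nat) (D : distr R n) (S : {set cube n}) : R :=
  \sum_(x in S) D x.

Definition dTV (R : realType) (n : nat) (D1 D2 : distr R n) : R :=
  2^-1 * \sum_(x : cube n) `|D1 x - D2 x|.

(* |D2 x / D1 x - 1|, with the conventions 0 / 0 = 1 and a / 0 = +oo for a > 0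
   (the field convention a / 0 = 0 would be wrong outside the support of D1). *)
Definition ratio_dev (R : realType) (n : nat) (D1 D2 : distr R n) (x : cube n) : \bar R :=
  if D1 x == 0 then (if D2 x == 0 then 0%E else +oo%E)
  else (`|D2 x / D1 x - 1|)%:E.

Definition dinf (R : realType) (n : nat) (D1 D2 : distr R n) : \bar R :=
  \big[maxe/0%E]_(x : cube n) ratio_dev D1 D2 x.

Inductive verdict := Accept | Reject.

Definition is_verdict (v w : verdict) : bool :=
  match v, w with
  | Accept, Accept | Reject, Reject => true
  | _, _ => false
  end.

(* Randomized adaptive algorithms over {0,1}^n as decision trees: internal fair
   coin flips, and calls to the oracles DUAL for P (SampP, EvalP), SAMP and
   PCOND for Q (SampQ, PcondQ); the continuation receives the answer. *)
Inductive algo (R : realType) (n : nat) : Type :=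
| Return of verdict
| Flip of (bool -> algo R n)
| SampP of (cube n -> algo R n)
| EvalP of cube n & (R -> algo R n)
| SampQ of (cube n -> algo R n)
| PcondQ of {set cube n} & (cube n -> algo R n).

Section Semantics.
Variables (R : realType) (n : nat) (P Q : distr R n).

Fixpoint prob_returns (v : verdict) (A : algo R n) : R :=
  match A with
  | Return w => (is_verdict v w)%:R
  | Flip k => 2^-1 * prob_returns v (k true) + 2^-1 * prob_returns v (k false)
  | SampP k => \sum_(x : cube n) P x * prob_returns v (k x)
  | EvalP x k => prob_returns v (k (P x))
  | SampQ k => \sum_(x : cube n) Q x * prob_returns v (k x)
  | PcondQ T k => \sum_(x in T) Q x / mass Q T * prob_returns v (k x)
  end.

(* Every PCOND query made in an execution of positive probability satisfies the
   precondition of the oracle. *)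
Fixpoint legal (A : algo R n) : Prop :=
  match A with
  | Return _ => True
  | Flip k => forall b, legal (k b)
  | SampP k => forall x, 0 < P x -> legal (k x)
  | EvalP x k => legal (k (P x))
  | SampQ k => forall x, 0 < Q x -> legal (k x)
  | PcondQ T k =>
      [/\ #|T| = 2%N, 0 < mass Q T
        & forall x, x \in T -> 0 < Q x -> legal (k x)]
  end.

(* Largest number of oracle calls over the executions of positive probability. *)
Fixpoint queries (A : algo R n) : nat :=
  match A with
  | Return _ => 0
  | Flip k => maxn (queries (k true)) (queries (k false))
  | SampP k => (\max_(x : cube n | 0 < P x) queries (k x)).+1
  | EvalP x k => (queries (k (P x))).+1
  | SampQ k => (\max_(x : cube n | 0 < Q x) queries (k x)).+1
  | PcondQ T k => (\max_(x in T | 0 < Q x) queries (k x)).+1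
  end.

End Semantics.

(* The factor hidden by the soft O. Every polynomial in the three logarithms is
   bounded by a constant times such a power. For eps = 0 we have ln 0^-1 = 0, so
   no dependence on eps is hidden there. *)
Definition polylog (R : realType) (c : nat) (eps eta delta : R) : R :=
  (1 + ln eps^-1 + ln eta^-1 + ln delta^-1) ^+ c.

Definition query_bound (R : realType) (n : nat) (eta eps : R) : R :=
  Num.sqrt n%:R * ln n%:R / (eta ^+ 3 * (eta - 116 / 10 * eps))
  + n%:R / eta ^+ 2.

(* Main.v *)
Require Import Defs.
From HB Require Import structures.
From mathcomp Require Import all_boot all_order all_algebra.
From mathcomp Require Import all_classical all_reals ereal sequences exp.
From mathcomp Require Import ring lra zify.

Import Order.TTheory GRing.Theory Num.Theory.
Local Open Scope ring_scope.

(** The support is cut into [k = n + O(log (1/eta))] buckets according to the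
    dyadic scale of [P x]; the last bucket has [P]-mass at most [eta/8].
    Learning the bucket histograms of [P] and [Q] with [O(k/eta^2)] samples
    detects any discrepancy between bucket masses. If these masses agree up to
    [3 eta/4] although [dTV P Q > eta], then, with [a_i] the [P]-mass of the
    points of bucket [i] having [Q <= (1 - eta/4) P] and [b_i] the [Q]-mass of
    those having [Q >= (1 + eta/4) P], the sum of [min a_i b_i] is at least
    [eta/4].  Draw [x ~ P], then [k] samples from [Q], and keep the first one,
    [y], that falls in the bucket of [x]: the pair is discrepant with probability
    at least [sum_i a_i b_i k / (1 + k q_i)], where [q_i] is the [Q]-mass of
    bucket [i], hence at least [eta^2/32] by Cauchy-Schwarz.
    So [O(1/eta^2)] pairs suffice; within a bucket [P x / P y] lies in [1/2, 2],
    so [O(log (1/eta)/eta^2)] PCOND queries per pair decide whether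
    [Q y / Q x] exceeds [P y / P x] by a factor [1 + Omega(eta)]. A majority
    vote over [O(log (1/delta))] runs gives confidence [1 - delta]. *)

(** * A monadic language of oracle programs *)

Inductive prog (R : realType) (n : nat) (T : Type) : Type :=
| Ret of T
| DrawP of (cube n -> prog R n T)
| ValueP of cube n & (R -> prog R n T)
| DrawQ of (cube n -> prog R n T)
| PairQ of {set cube n} & (cube n -> prog R n T).

Arguments Ret {R n T}.
Arguments DrawP {R n T}.
Arguments ValueP {R n T}.
Arguments DrawQ {R n T}.
Arguments PairQ {R n T}.

(** Leaves of arbitrary type, unlike those of [algo], exist for this composition: a subroutine can
    hand a label, a point or a list of answers to its continuation. [compile] returns to [algo] once
    the leaves are verdicts. *)
Fixpoint bind {R : realType} {n : nat} {T U : Type}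
    (p : prog R n T) (g : T -> prog R n U) : prog R n U :=
  match p with
  | Ret t => g t
  | DrawP k => DrawP (fun x => bind (k x) g)
  | ValueP x k => ValueP x (fun v => bind (k v) g)
  | DrawQ k => DrawQ (fun x => bind (k x) g)
  | PairQ A k => PairQ A (fun x => bind (k x) g)
  end.

Fixpoint compile {R : realType} {n : nat} (p : prog R n verdict) : algo R n :=
  match p with
  | Ret t => Return R n t
  | DrawP k => SampP (fun x => compile (k x))
  | ValueP x k => EvalP x (fun v => compile (k v))
  | DrawQ k => SampQ (fun x => compile (k x))
  | PairQ A k => PcondQ A (fun x => compile (k x))
  end.

Fixpoint rep {R : realType} {n : nat} {T : Type} (m : nat) (p : prog R n T) :
    prog R n (seq T) :=
  match m with
  | 0%N => Ret [::]
  | m'.+1 => bind p (fun t => bind (rep m' p) (fun s => Ret (t :: s)))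
  end.

Section Semantics.
Context {R : realType} {n : nat} (P Q : distr R n).

Fixpoint expect {T : Type} (p : prog R n T) (f : T -> R) : R :=
  match p with
  | Ret t => f t
  | DrawP k => \sum_(x : cube n) P x * expect (k x) f
  | ValueP x k => expect (k (P x)) f
  | DrawQ k => \sum_(x : cube n) Q x * expect (k x) f
  | PairQ A k => \sum_(x in A) Q x / mass Q A * expect (k x) f
  end.

(* All executions of positive probability are legal, make at most [c] queries
   and return a value satisfying [Phi]. *)
Fixpoint valid {T : Type} (p : prog R n T) (c : nat) (Phi : T -> Prop) : Prop :=
  match p, c with
  | Ret t, _ => Phi t
  | DrawP k, c'.+1 => forall x, 0 < P x -> valid (k x) c' Phi
  | ValueP x k, c'.+1 => valid (k (P x)) c' Phi
  | DrawQ k, c'.+1 => forall x, 0 < Q x -> valid (k x) c' Phi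
  | PairQ A k, c'.+1 =>
      [/\ #|A| = 2%N, 0 < mass Q A
        & forall x, x \in A -> 0 < Q x -> valid (k x) c' Phi]
  | _, 0%N => False
  end.

End Semantics.

(** * Program logic: expectations, legality and query budgets *)

Section ProgramLogic.
Context {R : realType} {n : nat} {P Q : distr R n}.
Local Notation Ex := (expect P Q).
Local Notation ok := (valid P Q).

Lemma Ex_bind {T U : Type} (p : prog R n T) (g : T -> prog R n U) f :
  Ex (bind p g) f = Ex p (fun t => Ex (g t) f).
Proof.
elim: p => [t|k IH|x k IH|k IH|A k IH] //=;
  by apply: eq_bigr => y _; rewrite IH.
Qed.

(** Each node is a weighted sum, so this holds for any weights, even at an illegal [PairQ] node.
    Only [Ex_cst] and monotonicity call for validity. *)
Lemma Ex_linear {T : Type} (p : prog R n T) a (f g : T -> R) :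
  Ex p (fun t => a * f t + g t) = a * Ex p f + Ex p g.
Proof.
elim: p => [t|k IH|x k IH|k IH|A k IH] //=; rewrite mulr_sumr -big_split /=;
  by apply: eq_bigr => x _; rewrite IH; ring.
Qed.

Lemma ok_weaken {T : Type} (p : prog R n T) c c' (Phi Phi' : T -> Prop) :
  ok p c Phi -> (c <= c')%N -> (forall t, Phi t -> Phi' t) -> ok p c' Phi'.
Proof.
move=> + + PhiP; elim: p c c' => [t|k IH|x k IH|k IH|A k IH] [|c] [|c'] //=;
  try by move=> H _; apply: PhiP.
- by move=> H le x Px; apply: IH (H x Px) _.
- by move=> H le; apply: IH H _.
- by move=> H le x Px; apply: IH (H x Px) _.
- by move=> [S2 S0 H] le; split=> // x xS Qx; apply: IH (H x xS Qx) _.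
Qed.

Lemma ok_bind {T U : Type} (p : prog R n T) (g : T -> prog R n U) c c' Phi Psi :
  ok p c Phi -> (forall t, Phi t -> ok (g t) c' Psi) ->
  ok (bind p g) (c + c')%N Psi.
Proof.
move=> + gP; elim: p c => [t|k IH|x k IH|k IH|A k IH] [|c] //=;
  try by move=> H; apply: ok_weaken (gP _ H) _ _ => //; lia.
- by move=> H x Px; apply: IH; apply: H.
- by move=> H; apply: IH; apply: H.
- by move=> H x Px; apply: IH; apply: H.
- by move=> [S2 S0 H]; split=> // x xS Qx; apply: IH (H x xS Qx).
Qed.

(** Validity speaks only of branches of positive probability; the other branches have weight 0 and
    contribute nothing to either side. *)
Lemma ler_Ex {T : Type} {p : prog R n T} {c Phi} (okp : ok p c Phi)
  (f g : T -> R) : (forall t, Phi t -> f t <= g t) -> Ex p f <= Ex p g.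
Proof.
move=> fg; elim: p c okp => [t|k IH|x k IH|k IH|A k IH] [|c] //=;
  try by move=> H; apply: fg.
- move=> H; apply: ler_sum => x _.
  have := pmf_ge0 P x; rewrite le_eqVlt => /predU1P[<-|Px].
    by rewrite !mul0r.
  by rewrite ler_wpM2l ?(ltW Px) //; apply: IH (H x Px).
- by move=> H; apply: IH; apply: H.
- move=> H; apply: ler_sum => x _.
  have := pmf_ge0 Q x; rewrite le_eqVlt => /predU1P[<-|Qx].
    by rewrite !mul0r.
  by rewrite ler_wpM2l ?(ltW Qx) //; apply: IH (H x Qx).
- move=> [S2 S0 H]; apply: ler_sum => x xS.
  have := pmf_ge0 Q x; rewrite le_eqVlt => /predU1P[<-|Qx].
    by rewrite !mul0r.
  by rewrite ler_wpM2l ?divr_ge0 ?(ltW Qx) ?(ltW S0) //; apply: IH (H x xS Qx).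
Qed.

(** The weights have total 1 at every node reached; at a [PairQ] node this is the positivity of the
    mass of the pair. *)
Lemma Ex_cst {T : Type} {p : prog R n T} {c Phi} (okp : ok p c Phi) a :
  Ex p (fun=> a) = a.
Proof.
elim: p c okp => [t|k IH|x k IH|k IH|A k IH] [|c] //=.
- move=> H; rewrite -[RHS]mul1r -(pmf_sum1 P) mulr_suml; apply: eq_bigr => x _.
  have := pmf_ge0 P x; rewrite le_eqVlt => /predU1P[<-|Px].
    by rewrite !mul0r.
  by rewrite (IH x c) //; apply: H.
- by move=> H; rewrite (IH _ c).
- move=> H; rewrite -[RHS]mul1r -(pmf_sum1 Q) mulr_suml; apply: eq_bigr => x _.
  have := pmf_ge0 Q x; rewrite le_eqVlt => /predU1P[<-|Qx].
    by rewrite !mul0r.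
  by rewrite (IH x c) //; apply: H.
- move=> [S2 S0 H]; rewrite -[RHS]mul1r -(divff (lt0r_neq0 S0)) {3}/mass !mulr_suml.
  apply: eq_bigr => x xS.
  have := pmf_ge0 Q x; rewrite le_eqVlt => /predU1P[<-|Qx].
    by rewrite !mul0r.
  by rewrite (IH x c) //; apply: H.
Qed.

Lemma ExD {T : Type} (p : prog R n T) (f g : T -> R) :
  Ex p (fun t => f t + g t) = Ex p f + Ex p g.
Proof.
rewrite -[in RHS](mul1r (Ex p f)) -Ex_linear; congr Ex.
by apply/funext => t; rewrite mul1r.
Qed.

Lemma ExZ {T : Type} (p : prog R n T) a (f : T -> R) :
  Ex p (fun t => a * f t) = a * Ex p f.
Proof.
elim: p => [t|k IH|x k IH|k IH|A k IH] //=; rewrite mulr_sumr;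
  by apply: eq_bigr => x _; rewrite IH; ring.
Qed.

Lemma Ex_sum {T : Type} {I : finType} {p : prog R n T} {c Phi}
    (okp : ok p c Phi) (f : I -> T -> R) :
  Ex p (fun t => \sum_i f i t) = \sum_i Ex p (f i).
Proof.
elim: (index_enum I) => [|i r IH]; rewrite ?big_nil ?big_cons.
  by rewrite -[RHS](Ex_cst okp); congr Ex; apply/funext => t; rewrite big_nil.
by rewrite -IH -ExD; congr Ex; apply/funext => t; rewrite big_cons.
Qed.

Lemma Ex_compl {T : Type} {p : prog R n T} {c Phi} (okp : ok p c Phi)
    (a : pred T) :
  Ex p (fun t => (a t)%:R) = 1 - Ex p (fun t => (~~ a t)%:R).
Proof.
apply/eqP; rewrite eq_sym subr_eq -ExD -[X in X == _](Ex_cst okp 1); apply/eqP.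
by congr Ex; apply/funext => t; case: (a t); rewrite ?addr0 ?add0r.
Qed.

Lemma Ex_ge0 {T : Type} {p : prog R n T} {c Phi} (okp : ok p c Phi)
    (f : T -> R) : (forall t, Phi t -> 0 <= f t) -> 0 <= Ex p f.
Proof. by move=> f0; rewrite -[X in X <= _](Ex_cst okp); apply: (ler_Ex okp). Qed.

Lemma Ex_le {T : Type} {p : prog R n T} {c Phi} (okp : ok p c Phi)
    (f : T -> R) a : (forall t, Phi t -> f t <= a) -> Ex p f <= a.
Proof. by move=> fa; rewrite -(Ex_cst okp a); apply: (ler_Ex okp). Qed.

(** This lemma and the next two carry the bounds proved for programs over to decision trees. *)
Lemma prob_compile (p : prog R n verdict) v :
  prob_returns P Q v (compile p) = Ex p (fun w => (is_verdict v w)%:R).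
Proof.
elim: p => [t|k IH|x k IH|k IH|A k IH] //=;
  by apply: eq_bigr => y _; rewrite IH.
Qed.

Lemma legal_compile (p : prog R n verdict) c Phi :
  ok p c Phi -> legal P Q (compile p).
Proof.
elim: p c => [t|k IH|x k IH|k IH|A k IH] [|c] //=.
- by move=> H x Px; apply: IH; apply: H.
- by move=> H; apply: IH; apply: H.
- by move=> H x Px; apply: IH; apply: H.
- by move=> [A2 A0 H]; split=> // x xA Qx; apply: IH (H x xA Qx).
Qed.

Lemma queries_compile (p : prog R n verdict) c Phi :
  ok p c Phi -> (queries P Q (compile p) <= c)%N.
Proof.
elim: p c => [t|k IH|x k IH|k IH|A k IH] [|c] //=.
- by move=> H; rewrite ltnS; apply/bigmax_leqP => x Px; apply: IH (H x Px).
- by move=> H; rewrite ltnS; apply: IH H.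
- by move=> H; rewrite ltnS; apply/bigmax_leqP => x Px; apply: IH (H x Px).
- move=> [A2 A0 H]; rewrite ltnS; apply/bigmax_leqP => x /andP[xA Qx].
  by apply: IH (H x xA Qx).
Qed.

Lemma ok_rep {T : Type} (p : prog R n T) c Phi m :
  ok p c Phi -> ok (rep m p) (m * c)%N (fun s => size s = m).
Proof.
move=> okp; elim: m => //= m IH; rewrite mulSn.
apply: ok_bind okp _ => t _; rewrite -[(m * c)%N]addn0.
by apply: ok_bind IH _ => s /= ->.
Qed.

Lemma Ex_repS {T : Type} (p : prog R n T) m f :
  Ex (rep m.+1 p) f = Ex p (fun t => Ex (rep m p) (fun s => f (t :: s))).
Proof.
by rewrite /= Ex_bind; congr Ex; apply/funext => t; rewrite Ex_bind.
Qed.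

End ProgramLogic.

(** * Concentration for repeated programs *)

(** From [expR (- s) >= 1 - s] one gets [expR s <= 1 / (1 - s)], and
    [(1 + s + 2 * s ^+ 2) * (1 - s)] is at least 1 when [s <= 1 / 2]. *)
Lemma expR_le_quadratic {R : realType} (s : R) :
  s <= 1 / 2 -> expR s <= 1 + s + 2 * s ^+ 2.
Proof.
move=> s2; have h : 1 - s <= expR (- s) := expR_ge1Dx (- s).
have e0 := expR_gt0 s.
have ee : expR s * expR (- s) = 1 by rewrite -expRD subrr expR0.
have hs : expR s * (1 - s) <= 1 by rewrite -[leRHS]ee ler_pM2l.
have q0 := sqr_ge0 s.
have : 1 <= (1 + s + 2 * s ^+ 2) * (1 - s).
  have -> : (1 + s + 2 * s ^+ 2) * (1 - s) = 1 + s ^+ 2 * (1 - 2 * s) by ring.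
  by rewrite lerDl mulr_ge0 //; lra.
by move/(le_trans hs); rewrite ler_pM2r //; lra.
Qed.

Section Concentration.
Context {R : realType} {n : nat} {P Q : distr R n}.
Local Notation Ex := (expect P Q).
Local Notation ok := (valid P Q).

(** Moment generating function of the count: each independent run contributes a factor
    [1 + (expR s - 1) * Ex h], which is at most [expR (s * mu + 2 * s ^+ 2)]. *)
Lemma Ex_rep_count_expR {T : Type} {p : prog R n T} {c Phi} (okp : ok p c Phi)
    (h : pred T) (mu s : R) m :
  0 <= s -> s <= 1 / 2 -> Ex p (fun t => (h t)%:R) <= mu -> mu <= 1 ->
  Ex (rep m p) (fun l => expR (s * (count h l)%:R))
    <= expR (m%:R * (s * mu + 2 * s ^+ 2)).
Proof.
move=> s0 s2 hmu mu1; elim: m => [|m IH].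
  by rewrite /= mulr0 mul0r.
rewrite Ex_repS.
have E t l : expR (s * (count h (t :: l))%:R)
    = ((expR s - 1) * (h t)%:R + 1) * expR (s * (count h l)%:R).
  rewrite /= natrD mulrDr expRD; congr (_ * _).
  by case: (h t); rewrite /= ?mulr1 ?mulr0 ?expR0 ?subrK ?add0r.
under [X in Ex _ X]funext => t do
  (under [X in Ex _ X]funext => l do rewrite E; rewrite ExZ mulrC).
rewrite ExZ Ex_linear (Ex_cst okp).
have -> : m.+1%:R * (s * mu + 2 * s ^+ 2) = m%:R * (s * mu + 2 * s ^+ 2)
    + (s * mu + 2 * s ^+ 2) by rewrite -natr1; ring.
rewrite expRD.
have e1 : 0 <= expR s - 1 by have := expR_ge1Dx s; lra.
apply: ler_pM => //.
- by apply: (Ex_ge0 (ok_rep _ _ _ m okp)) => l _; exact: expR_ge0.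
- by rewrite addr_ge0 // mulr_ge0 // (Ex_ge0 okp) // => t _; rewrite ler0n.
apply: le_trans (expR_ge1Dx _).
have es := expR_le_quadratic s s2; have q0 := sqr_ge0 s.
have mu0 : 0 <= mu by apply: le_trans hmu; apply: (Ex_ge0 okp) => t _.
have h1 := ler_wpM2l e1 hmu.
have h2 : (expR s - 1) * mu <= (s + 2 * s ^+ 2) * mu by rewrite ler_wpM2r //; lra.
have h3 : s ^+ 2 * mu <= s ^+ 2 by rewrite ler_piMr.
lra.
Qed.

(** Chernoff's method: Markov's inequality applied to [expR (s * count)]. *)
Lemma count_upper_tail {T : Type} {p : prog R n T} {c Phi} (okp : ok p c Phi)
    (h : pred T) (mu d : R) m :
  0 <= d -> d <= 2 -> Ex p (fun t => (h t)%:R) <= mu -> mu <= 1 ->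
  Ex (rep m p) (fun l => (m%:R * (mu + d) <= (count h l)%:R)%R%:R)
    <= expR (- (m%:R * d ^+ 2 / 8)).
Proof.
move=> d0 d2 hmu mu1; have okm := ok_rep _ _ _ m okp.
(* This [s] minimises the exponent [2 * s ^+ 2 - s * d], with value [- d ^+ 2 / 8]; [d <= 2] ensures
   [s <= 1 / 2]. *)
pose s := d / 4; pose E := expR (- (s * (m%:R * (mu + d)))).
apply: (@le_trans _ _ (E * expR (m%:R * (s * mu + 2 * s ^+ 2)))).
  apply: le_trans (ler_wpM2l (expR_ge0 _)
    (Ex_rep_count_expR okp h mu s m _ _ hmu mu1)); rewrite /s; try lra.
  rewrite -ExZ; apply: (ler_Ex okm) => l _; rewrite -expRD.
  have [le|_] := leP (m%:R * (mu + d)) _; last exact: expR_ge0.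
  by rewrite -[leLHS]expR0 ler_expR addrC subr_ge0 ler_wpM2l //; lra.
rewrite /E -expRD ler_expR le_eqVlt; apply/orP; left; apply/eqP.
by rewrite /s; field.
Qed.

Lemma Ex_rep_count {T : Type} {p : prog R n T} {c Phi} (okp : ok p c Phi)
    (h : pred T) m :
  Ex (rep m p) (fun l => (count h l)%:R) = m%:R * Ex p (fun t => (h t)%:R).
Proof.
have okm k := ok_rep _ _ _ k okp.
elim: m => [|m IH]; first by rewrite mul0r.
rewrite Ex_repS /=.
under [X in Ex _ X]funext => t do
  (under [X in Ex _ X]funext => l do rewrite natrD;
   rewrite ExD (Ex_cst (okm m))).
by rewrite ExD (Ex_cst okp) IH -natr1 mulrDl mul1r addrC.
Qed.

(** Induction on the number of runs: the cross term has mean zero, and one more 0/1 trial adds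
    [mu - mu ^+ 2 <= mu] to the variance. *)
Lemma Ex_rep_count_var {T : Type} {p : prog R n T} {c Phi} (okp : ok p c Phi)
    (h : pred T) m :
  Ex (rep m p) (fun l => ((count h l)%:R
      - m%:R * Ex p (fun t => (h t)%:R)) ^+ 2)
    <= m%:R * Ex p (fun t => (h t)%:R).
Proof.
set mu := Ex p _; have okm k := ok_rep _ _ _ k okp.
elim: m => [|m IH]; first by rewrite /= !mul0r subr0 expr0n.
rewrite Ex_repS.
have E t l : ((count h (t :: l))%:R - m.+1%:R * mu) ^+ 2 =
    2 * ((h t)%:R - mu) * (count h l)%:R
    + (((count h l)%:R - m%:R * mu) ^+ 2
       + (((h t)%:R - mu) ^+ 2 - 2 * ((h t)%:R - mu) * (m%:R * mu))).
  by rewrite /= natrD -natr1; ring.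
under [X in Ex _ X]funext => t do
  (under [X in Ex _ X]funext => l do rewrite E;
   rewrite Ex_linear ExD (Ex_cst (okm m)) (Ex_rep_count okp) -/mu).
set V := Ex (rep m p) _ in IH *.
have F t : 2 * ((h t)%:R - mu) * (m%:R * mu) + (V + (((h t)%:R - mu) ^+ 2
    - 2 * ((h t)%:R - mu) * (m%:R * mu))) = (1 - 2 * mu) * (h t)%:R + (V + mu ^+ 2).
  by case: (h t); rewrite /=; ring.
under [X in Ex _ X]funext => t do rewrite F.
rewrite Ex_linear (Ex_cst okp) -/mu -natr1.
have := sqr_ge0 mu; lra.
Qed.

(* [|X| <= (X^2 / c + c) / 2] with the same [c] for all bins replaces the
   Cauchy-Schwarz inequality over the bins. *)
Lemma histogram_error {T : Type} {I : finType} {p : prog R n T} {c Phi}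
    (okp : ok p c Phi) (b : T -> I) m (e nu : R) :
  0 < e -> 0 < nu -> (0 < #|I|)%N -> #|I|%:R <= m%:R * e ^+ 2 ->
  Ex (rep m p) (fun l => (m%:R * nu < \sum_i
      `|(count (fun t => b t == i) l)%:R
        - m%:R * Ex p (fun t => (b t == i)%:R)|)%R%:R) <= e / nu.
Proof.
move=> e0 nu0 I0 Im; have okm := ok_rep _ _ _ m okp.
have k0 : 0 < #|I|%:R :> R by rewrite ltr0n.
set k := #|I|%:R in k0 Im *.
have m0 : 0 < m%:R :> R.
  by have := lt_le_trans k0 Im; rewrite pmulr_lgt0 // exprn_gt0.
(* With this [a], the expected total is at most [(m / a + k * a) / 2], where [k * a = m * e] and
   [m / a = k / e <= m * e]. Markov's inequality then gives [e / nu]. *)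
pose a := m%:R * e / k; have a0 : 0 < a by rewrite divr_gt0 // mulr_gt0.
pose mu i := Ex p (fun t => (b t == i)%:R).
pose X i l := ((count (fun t => b t == i) l)%:R - m%:R * mu i) ^+ 2.
have mu1 : \sum_i mu i = 1.
  rewrite -(Ex_sum okp) -[RHS](Ex_cst okp 1); congr Ex; apply/funext => t.
  rewrite (bigD1 (b t)) //= eqxx big1 ?addr0 // => i.
  by rewrite eq_sym => /negbTE ->.
apply: (@le_trans _ _ (Ex (rep m p) (fun l =>
    (m%:R * nu)^-1 * \sum_i (2^-1 * (X i l / a + a))))).
  apply: (ler_Ex okm) => l _; case: ltP => [lt|_].
    rewrite /= mulrC ler_pdivlMr ?mulr_gt0 // mul1r; apply/ltW/(lt_le_trans lt).
    apply: ler_sum => i _; rewrite /X -/(mu i); move: (_ - _) => x.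
    rewrite -real_normK ?num_real //; have := normr_ge0 x; move: `|x| => y y0.
    have -> : 2^-1 * (y ^+ 2 / a + a) = y + (y - a) ^+ 2 / (2 * a) by field; lra.
    by rewrite lerDl divr_ge0 ?sqr_ge0 //; lra.
  rewrite mulr_ge0 ?invr_ge0 ?mulr_ge0 ?(ltW m0) ?(ltW nu0) //.
  apply: sumr_ge0 => i _; rewrite mulr_ge0 ?invr_ge0 //.
  by apply: addr_ge0 (ltW a0); apply: divr_ge0 (sqr_ge0 _) (ltW a0).
rewrite ExZ (Ex_sum okm).
have -> : e / nu = (m%:R * nu)^-1 * (m%:R * e) by field; lra.
rewrite ler_pM2l ?invr_gt0 ?mulr_gt0 //.
apply: (@le_trans _ _ (\sum_i ((2 * a)^-1 * (m%:R * mu i) + a / 2))).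
  apply: ler_sum => i _.
  have E l : 2^-1 * (X i l / a + a) = (2 * a)^-1 * X i l + a / 2 by field; lra.
  under [X in Ex _ X]funext => l do rewrite E.
  rewrite Ex_linear (Ex_cst okm) lerD2r ler_wpM2l //.
    by rewrite invr_ge0 mulr_ge0 // ltW.
  exact: (Ex_rep_count_var okp).
have -> : \sum_i ((2 * a)^-1 * (m%:R * mu i) + a / 2)
    = (2 * a)^-1 * m%:R + k * (a / 2).
  by rewrite big_split /= sumr_const -!mulr_sumr mu1 mulr1 [X in _ = _ + X]mulr_natl.
have -> : (2 * a)^-1 * m%:R = k / (2 * e) by rewrite /a; field; lra.
have -> : k * (a / 2) = m%:R * e / 2 by rewrite /a; field; lra.
have : k / (2 * e) <= m%:R * e / 2.
  rewrite ler_pdivrMr ?mulr_gt0 //; apply: le_trans Im _.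
  by rewrite le_eqVlt; apply/orP; left; apply/eqP; field.
lra.
Qed.

End Concentration.

(** * The subroutines of the tester *)

Section Programs.
Context {R : realType} {n : nat}.

Definition labelP {I : finType} (b : cube n -> R -> I) : prog R n I :=
  DrawP (fun x => ValueP x (fun v => Ret (b x v))).

(** Samples of [Q] are also binned by their value under [P], so that both histograms refer to one
    partition of the cube. *)
Definition labelQ {I : finType} (b : cube n -> R -> I) : prog R n I :=
  DrawQ (fun x => ValueP x (fun v => Ret (b x v))).

(* The tests return [true] for rejection. *)
Definition histogram_test {I : finType} (b : cube n -> R -> I) (m : nat)
    (theta : R) : prog R n bool :=
  bind (rep m (labelP b)) (fun s => bind (rep m (labelQ b)) (fun s' =>
    Ret (m%:R * theta
         < \sum_i `|(count (fun t => t == i) s)%:R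
                    - (count (fun t => t == i) s')%:R|)%R)).

Fixpoint find_first (l : nat) (B : pred R) : prog R n (option (cube n * R)) :=
  match l with
  | 0%N => Ret None
  | l'.+1 => DrawQ (fun y => ValueP y (fun v =>
               if B v then Ret (Some (y, v)) else find_first l' B))
  end.

Definition pair_test (m : nat) (x y : cube n) (tau : R) : prog R n bool :=
  bind (rep m (PairQ [set x; y]%SET Ret)) (fun s =>
    Ret (m%:R * tau < (count (fun z => z == y) s)%:R)%R).

(** [i0] stands for the bucket in which ratios of [P] are not controlled; it is skipped. The case
    [x == y] is excluded because PCOND wants two distinct points. *)
Definition bucket_pair_test {I : finType} (b : R -> I) (i0 : I) (l m : nat)
    (tau : R -> R -> R) : prog R n bool :=
  DrawP (fun x => ValueP x (fun v =>
    if b v == i0 then Ret false else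
    bind (find_first l (fun w => b w == b v)) (fun o =>
      if o is Some (y, w) then
        if x == y then Ret false else pair_test m x y (tau v w)
      else Ret false))).

Fixpoint any_of (m : nat) (p : prog R n bool) : prog R n bool :=
  match m with
  | 0%N => Ret false
  | m'.+1 => bind p (fun r => if r then Ret true else any_of m' p)
  end.

Definition majority (m : nat) (p : prog R n bool) : prog R n verdict :=
  bind (rep m p) (fun s =>
    Ret (if (m < 2 * count id s)%N then Reject else Accept)).

End Programs.

(** * Error bounds of the subroutines *)

Section ProgramAnalysis.
Context {R : realType} {n : nat} {P Q : distr R n}.
Local Notation Ex := (expect P Q).
Local Notation ok := (valid P Q).

Section Histogram.
Context {I : finType}.
Variable b : cube n -> R -> I.

Definition bin_mass (D : distr R n) (i : I) : R :=
  \sum_(x | b x (P x) == i) D x.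

Lemma ok_labelP : ok (labelP b) 2 (fun=> True).
Proof. by []. Qed.

Lemma ok_labelQ : ok (labelQ b) 2 (fun=> True).
Proof. by []. Qed.

Lemma Ex_labelP i : Ex (labelP b) (fun t => (t == i)%:R) = bin_mass P i.
Proof.
rewrite /= /bin_mass [RHS]big_mkcond /=; apply: eq_bigr => x _.
by case: eqP => _; rewrite ?mulr1 ?mulr0.
Qed.

Lemma Ex_labelQ i : Ex (labelQ b) (fun t => (t == i)%:R) = bin_mass Q i.
Proof.
rewrite /= /bin_mass [RHS]big_mkcond /=; apply: eq_bigr => x _.
by case: eqP => _; rewrite ?mulr1 ?mulr0.
Qed.

Let err D m (s : seq I) : R :=
  \sum_i `|(count (fun t => t == i) s)%:R - m%:R * bin_mass D i|.

Lemma ok_histogram_test m theta :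
  ok (histogram_test b m theta) (m * 4) (fun=> True).
Proof.
have -> : (m * 4 = m * 2 + (m * 2 + 0))%N by lia.
apply: ok_bind (ok_rep _ _ _ _ ok_labelP) _ => s _.
by apply: ok_bind (ok_rep _ _ _ _ ok_labelQ) _.
Qed.

(** Union bound: the event [a] forces at least one of the two empirical histograms to be off by more
    than [m * nu]. *)
Lemma two_histograms m e nu (a : seq I -> seq I -> bool) :
  0 < e -> 0 < nu -> (0 < #|I|)%N -> #|I|%:R <= m%:R * e ^+ 2 ->
  (forall s s', err P m s <= m%:R * nu -> err Q m s' <= m%:R * nu ->
    ~~ a s s') ->
  Ex (rep m (labelP b)) (fun s =>
    Ex (rep m (labelQ b)) (fun s' => (a s s')%:R)) <= 2 * e / nu.
Proof.
move=> e0 nu0 I0 Im aP.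
have okP := ok_rep _ _ _ m ok_labelP; have okQ := ok_rep _ _ _ m ok_labelQ.
apply: (@le_trans _ _ (Ex (rep m (labelP b)) (fun s =>
    (m%:R * nu < err P m s)%R%:R + Ex (rep m (labelQ b)) (fun s' =>
    (m%:R * nu < err Q m s')%R%:R)))).
  apply: (ler_Ex okP) => s _; rewrite -[X in X + _](Ex_cst okQ) -ExD.
  apply: (ler_Ex okQ) => s' _.
  case: (boolP (a s s')) => [as'|_] /=; last by rewrite addr_ge0.
  have [lP|_] := leP (err P m s) (m%:R * nu); last by rewrite lerDl.
  have [lQ|_] := leP (err Q m s') (m%:R * nu); last by rewrite lerDr.
  by move: as'; rewrite (negbTE (aP _ _ lP lQ)).
rewrite ExD (Ex_cst okP) (_ : 2 * e / nu = e / nu + e / nu); last by ring.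
have hP := histogram_error ok_labelP id m e nu e0 nu0 I0 Im.
have hQ := histogram_error ok_labelQ id m e nu e0 nu0 I0 Im.
apply: lerD.
  apply: le_trans hP; rewrite le_eqVlt; apply/orP; left; apply/eqP.
  congr Ex; apply/funext => s; congr ((_ < _)%R%:R); apply: eq_bigr => i _.
  by rewrite Ex_labelP.
apply: le_trans hQ; rewrite le_eqVlt; apply/orP; left; apply/eqP.
congr Ex; apply/funext => s; congr ((_ < _)%R%:R); apply: eq_bigr => i _.
by rewrite Ex_labelQ.
Qed.

Let dist : R := \sum_i `|bin_mass P i - bin_mass Q i|.

Let dist_err m s s' : m%:R * dist <=
  \sum_i `|(count (fun t => t == i) s)%:R - (count (fun t => t == i) s')%:R|
  + err P m s + err Q m s'.
Proof.
rewrite /dist /err -!big_split /= mulr_sumr; apply: ler_sum => i _.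
rewrite -{1}(normr_nat R m) -normrM.
set u := _%:R - _ * bin_mass P i; set w := _%:R - _ * bin_mass Q i.
set z := _%:R - _%:R.
have -> : m%:R * (bin_mass P i - bin_mass Q i) = z - u + w.
  by rewrite /z /u /w; ring.
by rewrite (le_trans (ler_normD _ _)) // lerD2r (le_trans (ler_normB _ _)).
Qed.

Let err_dist m s s' :
  \sum_i `|(count (fun t => t == i) s)%:R - (count (fun t => t == i) s')%:R|
  <= m%:R * dist + err P m s + err Q m s'.
Proof.
rewrite /dist /err mulr_sumr -!big_split /=; apply: ler_sum => i _.
rewrite -{1}(normr_nat R m) -normrM.
set u := _%:R - _ * bin_mass P i; set w := _%:R - _ * bin_mass Q i.
set z := _%:R - _%:R.
have -> : m%:R * (bin_mass P i - bin_mass Q i) = z - u + w.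
  by rewrite /z /u /w; ring.
have {1}-> : z = (z - u + w) + u - w by ring.
by rewrite (le_trans (ler_normB _ _)) // lerD2r ler_normD.
Qed.

Lemma histogram_test_close m e nu theta :
  0 < e -> 0 < nu -> (0 < #|I|)%N -> #|I|%:R <= m%:R * e ^+ 2 ->
  dist <= theta - 2 * nu ->
  Ex (histogram_test b m theta) (fun r => r%:R) <= 2 * e / nu.
Proof.
move=> e0 nu0 I0 Im close; rewrite /histogram_test Ex_bind.
under [X in Ex _ X]funext => s do rewrite Ex_bind.
apply: two_histograms => // s s' hP hQ; rewrite -leNgt.
have := err_dist m s s'; have : m%:R * dist <= m%:R * (theta - 2 * nu).
  by rewrite ler_wpM2l.
lra.
Qed.

Lemma histogram_test_far m e nu theta :
  0 < e -> 0 < nu -> (0 < #|I|)%N -> #|I|%:R <= m%:R * e ^+ 2 ->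
  theta + 2 * nu < dist ->
  Ex (histogram_test b m theta) (fun r => (~~ r)%:R) <= 2 * e / nu.
Proof.
move=> e0 nu0 I0 Im far; rewrite /histogram_test Ex_bind.
under [X in Ex _ X]funext => s do rewrite Ex_bind.
apply: two_histograms => // s s' hP hQ; rewrite negbK.
have m0 : 0 < m%:R :> R.
  have : 0 < #|I|%:R :> R by rewrite ltr0n.
  by move/lt_le_trans/(_ Im); rewrite pmulr_lgt0 // exprn_gt0.
have := dist_err m s s'; have : m%:R * (theta + 2 * nu) < m%:R * dist.
  by rewrite ltr_pM2l.
lra.
Qed.

End Histogram.

Lemma ok_find_first l B : ok (find_first l B) (l * 2)
  (fun o => if o is Some (y, v) then [/\ v = P y, B v & 0 < Q y] else True).
Proof.
by elim: l => //= l IH y Qy; case: ifP.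
Qed.

(** With [h] and [q] the two sums, the exact value is [h * (1 - (1 - q) ^ l) / q]. The bound
    [h * l / (1 + l * q)] avoids dividing by [q] and follows by induction from the recurrence
    [p_(l+1) = h + (1 - q) * p_l]. *)
Lemma find_first_hit l (B : pred R) (H : pred (cube n)) :
  (\sum_(y | B (P y) && H y) Q y) * (l%:R / (1 + l%:R * \sum_(y | B (P y)) Q y))
    <= Ex (find_first l B) (fun o => if o is Some (y, _) then (H y)%:R else 0).
Proof.
set h := \sum_(y | _ && _) _; set q := \sum_(y | _) _.
have h0 : 0 <= h by apply: sumr_ge0 => y _; exact: pmf_ge0.
have q0 : 0 <= q by apply: sumr_ge0 => y _; exact: pmf_ge0.
elim: l => [|l IH]; first by rewrite mul0r mulr0.
set f := (fun o => _) in IH *.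
(* The first draw falls in [B] or, with probability [1 - q], the search starts afresh. *)
have -> : Ex (find_first l.+1 B) f = h + (1 - q) * Ex (find_first l B) f.
  rewrite /= mulrBl mul1r -[X in h + (X - _)]mul1r -{1}(pmf_sum1 Q) addrA.
  apply/eqP; rewrite eq_sym subr_eq; apply/eqP.
  rewrite /h /q !mulr_suml big_mkcond [X in _ = _ + X]big_mkcond -!big_split /=.
  apply: eq_bigr => y _; case: (B (P y)) => /=; last by rewrite add0r addr0.
  by case: (H y); rewrite ?mulr1 ?mulr0 ?add0r.
have q1 : q <= 1.
  rewrite -(pmf_sum1 Q) /q big_mkcond; apply: ler_sum => y _.
  by case: ifP => // _; exact: pmf_ge0.
have l0 : 0 <= l%:R :> R by [].
have lq : 0 <= l%:R * q by rewrite mulr_ge0.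
apply: (@le_trans _ _ (h + (1 - q) * (h * (l%:R / (1 + l%:R * q))))); last first.
  by rewrite lerD2l ler_wpM2l // subr_ge0.
have -> : h + (1 - q) * (h * (l%:R / (1 + l%:R * q)))
    = h * (l.+1%:R / (1 + l%:R * q)).
  by rewrite -natr1; field; rewrite lt0r_neq0 // ltr_wpDr.
rewrite ler_wpM2l // ler_wpM2l // lef_pV2 ?posrE.
- by rewrite lerD2l ler_wpM2r // ler_nat.
- by rewrite ltr_wpDr // mulr_ge0.
- by rewrite ltr_wpDr.
Qed.

Section Pair.
Variables (x y : cube n).
Hypotheses (xy : x != y) (Qy : 0 < Q y).

Let Qxy : 0 < Q x + Q y.
Proof. by rewrite ltr_wpDl // pmf_ge0. Qed.

Let massE : mass Q [set x; y]%SET = Q x + Q y.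
Proof. by rewrite /mass big_setU1 ?big_set1 // inE. Qed.

(** Since [y] has been drawn from [Q], the pair is a legal query even if [Q x = 0]. *)
Let ok_pair : ok (PairQ [set x; y]%SET Ret) 1 (fun=> True).
Proof. by split=> //; rewrite ?cards2 ?xy // massE. Qed.

Lemma ok_pair_test m tau : ok (pair_test m x y tau) m (fun=> True).
Proof.
have {2}-> : m = (m * 1 + 0)%N by lia.
by apply: ok_bind (ok_rep _ _ _ _ ok_pair) _.
Qed.

Let Ex_pair f : Ex (PairQ [set x; y]%SET Ret) f
  = Q x / (Q x + Q y) * f x + Q y / (Q x + Q y) * f y.
Proof. by rewrite /= massE big_setU1 ?big_set1 // inE. Qed.

Lemma pair_test_low m tau d : 0 <= d -> d <= 2 ->
  tau <= 1 -> Q y / (Q x + Q y) <= tau - d ->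
  Ex (pair_test m x y tau) (fun r => r%:R) <= expR (- (m%:R * d ^+ 2 / 8)).
Proof.
move=> d0 d2 t1 h; rewrite /pair_test Ex_bind /=.
have mu1 : tau - d <= 1 by lra.
have hmu : Ex (PairQ [set x; y]%SET Ret) (fun z => (z == y)%:R) <= tau - d.
  by rewrite Ex_pair (negbTE xy) eqxx mulr0 add0r mulr1.
apply: le_trans (count_upper_tail ok_pair _ _ _ m d0 d2 hmu mu1).
apply: (ler_Ex (ok_rep _ _ _ _ ok_pair)) => s _.
rewrite subrK.
by have [/ltW ->|_] := ltP (m%:R * tau) (count (fun z => z == y) s)%:R.
Qed.

(** A low count of [y] is a high count of the other point, so the upper tail bound serves here
    too. *)
Lemma pair_test_high m tau d : 0 <= d -> d <= 2 ->
  0 <= tau -> Q x / (Q x + Q y) <= 1 - tau - d ->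
  Ex (pair_test m x y tau) (fun r => (~~ r)%:R) <= expR (- (m%:R * d ^+ 2 / 8)).
Proof.
move=> d0 d2 t0 h; rewrite /pair_test Ex_bind /=.
have mu1 : 1 - tau - d <= 1 by lra.
have hmu : Ex (PairQ [set x; y]%SET Ret) (fun z => (z != y)%:R) <= 1 - tau - d.
  by rewrite Ex_pair (negbTE xy) eqxx mulr0 addr0 mulr1.
apply: le_trans (count_upper_tail ok_pair _ _ _ m d0 d2 hmu mu1).
apply: (ler_Ex (ok_rep _ _ _ _ ok_pair)) => s sm.
rewrite -leNgt subrK.
have [le|_] := leP (count (fun z => z == y) s)%:R (m%:R * tau); last by [].
suff -> : m%:R * (1 - tau) <= (count (fun z => z != y) s)%:R by [].
have := count_predC (fun z => z == y) s.
rewrite sm => /(congr1 (fun k => k%:R : R)); rewrite natrD.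
have -> : count (predC (fun z => z == y)) s = count (fun z => z != y) s by [].
lra.
Qed.

End Pair.

End ProgramAnalysis.

Lemma ler_average {R : realType} {n : nat} (D : distr R n) (f g : cube n -> R) :
  (forall x, 0 < D x -> f x <= g x) -> \sum_x D x * f x <= \sum_x D x * g x.
Proof.
move=> fg; apply: ler_sum => x _; have := pmf_ge0 D x.
rewrite le_eqVlt => /predU1P[<-|Dx]; first by rewrite !mul0r.
by rewrite ler_wpM2l ?(ltW Dx) // fg.
Qed.

(** [t <= expR (- s)] and [expR (m * s) >= 1 + m * s]. It bounds the probability that [m]
    independent trials of success probability at least [s] all fail. *)
Lemma expr_le_inv {R : realType} (t s : R) m :
  0 <= t -> 0 <= s -> t <= 1 - s -> t ^+ m <= (1 + m%:R * s)^-1.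
Proof.
move=> t0 s0 ts; have ms : 0 <= m%:R * s by rewrite mulr_ge0.
apply: (@le_trans _ _ (expR (- s) ^+ m)).
  by rewrite lerXn2r ?nnegrE ?expR_ge0 // (le_trans ts) // expR_ge1Dx.
rewrite -expRM_natl mulrN expRN lef_pV2 ?posrE ?expR_gt0 ?expR_ge1Dx //.
by rewrite ltr_wpDr.
Qed.

Section ProgramAnalysis.
Context {R : realType} {n : nat} {P Q : distr R n}.
Local Notation Ex := (expect P Q).
Local Notation ok := (valid P Q).

Lemma Ex_DrawP {T : Type} (k : cube n -> prog R n T) f :
  Ex (DrawP k) f = \sum_x P x * Ex (k x) f.
Proof. by []. Qed.

Lemma Ex_ValueP {T : Type} x (k : R -> prog R n T) f :
  Ex (ValueP x k) f = Ex (k (P x)) f.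
Proof. by []. Qed.

Section BucketPair.
Context {I : finType}.
Variables (b : R -> I) (i0 : I) (l m : nat) (tau : R -> R -> R) (d : R).
Hypotheses (d0 : 0 <= d) (d2 : d <= 2).

Let test : prog R n bool := bucket_pair_test b i0 l m tau.

Lemma ok_bucket_pair_test : ok test (2 + (l * 2 + m)) (fun=> True).
Proof.
rewrite /test /= => x Px; case: ifP => // _.
apply: ok_bind (ok_find_first _ _) _ => -[[y w] [_ _ Qy]|//].
by case: ifP => // /negbT xy; apply: ok_pair_test.
Qed.

Lemma bucket_pair_test_close :
  (forall x y, 0 < P x -> 0 < Q y -> x != y -> b (P y) = b (P x) ->
    b (P x) != i0 ->
    tau (P x) (P y) <= 1 /\ Q y / (Q x + Q y) <= tau (P x) (P y) - d) ->
  Ex test (fun r => r%:R) <= expR (- (m%:R * d ^+ 2 / 8)).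
Proof.
move=> H; set e := expR _; have e0 : 0 <= e by exact: expR_ge0.
rewrite [leRHS](_ : _ = \sum_x P x * e); last by rewrite -mulr_suml pmf_sum1 mul1r.
rewrite Ex_DrawP; apply: ler_average => x Px.
rewrite Ex_ValueP; case: ifPn => //= bx.
rewrite Ex_bind; apply: (Ex_le (ok_find_first _ _)) => -[[y w]|//].
move=> [-> /eqP by_ Qy]; case: ifPn => //= xy.
by have [? ?] := H x y Px Qy xy by_ bx; apply: pair_test_low.
Qed.

(** Given a low [x] in bucket [i], the search ends on a high [y] with the probability bounded in
    [find_first_hit], and the pair test then fires with probability at least [1 - expR (...)]. All
    other outcomes count as 0. *)
Lemma bucket_pair_test_far (low high : pred (cube n)) :
  (forall x y, low x -> high y -> 0 < P x -> 0 < Q y -> b (P y) = b (P x) ->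
    b (P x) != i0 ->
    [/\ x != y, 0 <= tau (P x) (P y)
      & Q x / (Q x + Q y) <= 1 - tau (P x) (P y) - d]) ->
  (1 - expR (- (m%:R * d ^+ 2 / 8))) *
    (\sum_(i | i != i0) (\sum_(x | (b (P x) == i) && low x) P x) *
      ((\sum_(y | (b (P y) == i) && high y) Q y) *
       (l%:R / (1 + l%:R * \sum_(y | b (P y) == i) Q y))))
    <= Ex test (fun r => r%:R).
Proof.
move=> H; set e := expR _.
have e1 : 0 <= 1 - e.
  by rewrite subr_ge0 expR_le1 oppr_le0 divr_ge0 // mulr_ge0 // sqr_ge0.
pose G i := (\sum_(y | (b (P y) == i) && high y) Q y) *
       (l%:R / (1 + l%:R * \sum_(y | b (P y) == i) Q y)).
apply: (@le_trans _ _ (\sum_x P x * (if (b (P x) != i0) && low x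
    then (1 - e) * G (b (P x)) else 0))); last first.
  rewrite Ex_DrawP; apply: ler_average => x Px; rewrite Ex_ValueP.
  case: (boolP ((b (P x) != i0) && low x)) => /= [/andP[bx lx]|_]; last first.
    case: ifPn => //= bx; rewrite Ex_bind.
    apply: (Ex_ge0 (ok_find_first _ _)) => -[[y w]|//] [_ _ Qy].
    case: ifPn => //= xy; apply: (Ex_ge0 (ok_pair_test _ _ xy Qy _ _)) => r _.
    exact: ler0n.
  rewrite (negbTE bx) Ex_bind.
  have := find_first_hit (P := P) (Q := Q) l (fun w => b w == b (P x)) high.
  move/(ler_wpM2l e1)/le_trans; apply; rewrite -ExZ.
  apply: (ler_Ex (ok_find_first _ _)) => -[[y w]|]; last by rewrite mulr0.
  move=> [-> /eqP by_ Qy]; case: (boolP (high y)) => hy; last first.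
    rewrite mulr0; case: ifPn => //= xy.
    by apply: (Ex_ge0 (ok_pair_test _ _ xy Qy _ _)) => r _.
  have [xy t0 h] := H x y lx hy Px Qy by_ bx; rewrite (negbTE xy) mulr1.
  rewrite (Ex_compl (ok_pair_test _ _ xy Qy _ _)) lerD2l lerN2.
  exact: pair_test_high.
rewrite le_eqVlt; apply/orP; left; apply/eqP; rewrite mulr_sumr.
transitivity (\sum_(x | (b (P x) != i0) && low x) P x * ((1 - e) * G (b (P x)))).
  rewrite (partition_big (fun x => b (P x)) (fun i => i != i0)) /=; last first.
    by move=> x /andP[].
  apply: eq_bigr => i ii0; rewrite mulrCA mulr_suml.
  apply: eq_big => [x|x /andP[/eqP-> _] //].
  by case: eqP => [->|_]; rewrite ?ii0 /= ?andbT ?andbF.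
by rewrite big_mkcond; apply: eq_bigr => x _; case: ifP => //= _; rewrite mulr0.
Qed.

End BucketPair.

Lemma ok_any_of (p : prog R n bool) c m :
  ok p c (fun=> True) -> ok (any_of m p) (m * c) (fun=> True).
Proof.
move=> okp; elim: m => //= m IH; rewrite mulSn.
by apply: ok_bind okp _ => -[].
Qed.

Lemma Ex_any_of_true {p : prog R n bool} {c} (okp : ok p c (fun=> True)) m :
  Ex (any_of m p) (fun r => r%:R) <= m%:R * Ex p (fun r => r%:R).
Proof.
elim: m => [|m IH]; first by rewrite mul0r.
rewrite /= Ex_bind -natr1 mulrDl mul1r addrC.
apply: le_trans (lerD (lexx _) IH).
rewrite -[X in _ <= _ + X](Ex_cst okp) -ExD; apply: (ler_Ex okp) => -[] _ /=.
  by rewrite lerDl (Ex_ge0 (ok_any_of _ _ _ okp)) // => r _; exact: ler0n.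
by rewrite add0r.
Qed.

Lemma Ex_any_of_false {p : prog R n bool} m :
  Ex (any_of m p) (fun r => (~~ r)%:R) = Ex p (fun r => (~~ r)%:R) ^+ m.
Proof.
elim: m => [|m IH]; first by rewrite expr0.
rewrite /= Ex_bind exprSr -IH -ExZ; congr Ex; apply/funext => -[] /=.
  by rewrite mulr0.
by rewrite mulr1.
Qed.

Lemma ok_majority (p : prog R n bool) c m :
  ok p c (fun=> True) -> ok (majority m p) (m * c) (fun=> True).
Proof.
move=> okp; rewrite -[(m * c)%N]addn0.
by apply: ok_bind (ok_rep _ _ _ _ okp) _.
Qed.

Lemma majority_error {p : prog R n bool} {c} (okp : ok p c (fun=> True)) m r0 :
  Ex p (fun r => (r != r0)%:R) <= 1 / 16 ->
  Ex (majority m p)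
    (fun w => (~~ is_verdict (if r0 then Reject else Accept) w)%:R)
    <= expR (- (m%:R / 64)).
Proof.
move=> hp.
have h1 : 0 <= 7 / 16 :> R by lra.
have h2 : 7 / 16 <= 2 :> R by lra.
have h3 : 1 / 16 <= 1 :> R by lra.
(* A wrong verdict needs at least half of the runs wrong, and [1 / 2 = 1 / 16 + 7 / 16]; moreover
   [(7 / 16) ^+ 2 / 8 >= 1 / 64]. A tie means [Accept], so it must be counted as an error when [r0]
   is [true]. *)
have m0 : 0 <= m%:R :> R by [].
apply: (@le_trans _ _ (expR (- (m%:R * (7 / 16) ^+ 2 / 8)))); last first.
  by rewrite ler_expR lerN2; lra.
apply: le_trans (count_upper_tail okp _ _ _ m h1 h2 hp h3).
rewrite /majority Ex_bind; apply: (ler_Ex (ok_rep _ _ _ _ okp)) => s sm /=.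
rewrite ler_nat.
have E : (m%:R * (1 / 16 + 7 / 16) <= (count (fun r => r != r0) s)%:R :> R)
    = (m <= 2 * count (fun r => r != r0) s)%N.
  by rewrite -(ler_nat R) natrM; apply/idP/idP => ?; lra.
rewrite E; have := count_predC id s; rewrite sm.
case: r0 {hp E} => /= cs.
  have -> : count (fun r => r != true) s = count (predC id) s.
    by apply: eq_count => -[].
  case: ltnP => //= le; rewrite lt0b; apply/idP; lia.
have -> : count (fun r => r != false) s = count id s by apply: eq_count => -[].
by case: ltnP => //= /ltnW ->.
Qed.

End ProgramAnalysis.

(** * Dyadic buckets and pair thresholds *)

Section Levels.
Context {R : realType}.

(* Level [j < K] is [2^-(j+1) < v <= 2^-j]; level [K] collects [v <= 2^-K]. *)
Definition level (K : nat) (v : R) : 'I_K.+1 :=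
  inord (find (fun j => 2^-1 ^+ j.+1 < v)%R (iota 0 K)).

Lemma levelE K v :
  level K v = find (fun j => 2^-1 ^+ j.+1 < v) (iota 0 K) :> nat.
Proof. by rewrite inordK // ltnS -[leqRHS](size_iota 0 K) find_size. Qed.

Lemma level_le K v : v <= 1 -> v <= 2^-1 ^+ level K v.
Proof.
move=> v1; have kK : (level K v <= K)%N by rewrite -ltnS.
case E: (nat_of_ord (level K v)) => [|j]; first by rewrite expr0.
have jf : (j < find (fun j => 2^-1 ^+ j.+1 < v)%R (iota 0 K))%N.
  by rewrite -levelE E.
have := before_find 0%N jf; rewrite nth_iota; last by rewrite -E in kK *; lia.
by rewrite add0n => /negbT; rewrite -leNgt.
Qed.

Lemma level_gt K v : level K v != ord_max -> 2^-1 ^+ (level K v).+1 < v.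
Proof.
move=> lm; have kK : (level K v < K)%N.
  rewrite ltn_neqAle -[(_ <= K)%N]ltnS ltn_ord andbT; apply: contra lm => /eqP E.
  exact/eqP/val_inj.
have hf : has (fun j => 2^-1 ^+ j.+1 < v) (iota 0 K).
  by rewrite has_find size_iota -levelE.
by have := nth_find 0%N hf; rewrite -levelE nth_iota.
Qed.

Lemma level_ratio K v w : v <= 1 -> level K v = level K w ->
  level K v != ord_max -> v <= 2 * w.
Proof.
move=> v1 vw; rewrite vw => /level_gt lw; have := level_le K v v1.
rewrite vw exprS in lw *; lra.
Qed.

Lemma level_gt0 K v : level K v != ord_max -> 0 < v.
Proof. by move/level_gt; apply: lt_trans; rewrite exprn_gt0 // invr_gt0. Qed.

End Levels.

Section Threshold.
Context {R : realType}.
Implicit Types (v w al be eta : R).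

(** With [v = P x] and [w = P y], the probability that PCOND on the pair returns [y] if
    [Q y = (1 + al) * P y] and [Q x = (1 - al) * P x]. *)
Definition pair_share al v w : R :=
  w * (1 + al) / (w * (1 + al) + v * (1 - al)).

(** The difference is exactly [2 * (al - be) * (v * w)] over the product of the denominators, and
    that product is at most [12 * (v * w)] because [v] and [w] agree up to a factor 2. *)
Lemma pair_share_gap al be v w : 0 < v -> 0 < w -> v <= 2 * w -> w <= 2 * v ->
  0 <= be -> be <= al -> al <= 1 / 4 ->
  pair_share be v w + (al - be) / 6 <= pair_share al v w.
Proof.
move=> v0 w0 vw wv b0 ba a4; rewrite /pair_share.
set A := w * (1 + al); set B := v * (1 - al).
set A' := w * (1 + be); set B' := v * (1 - be).
have A0 : 0 < A by rewrite mulr_gt0 //; lra.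
have B0 : 0 < B by rewrite mulr_gt0 //; lra.
have A'0 : 0 < A' by rewrite mulr_gt0 //; lra.
have B'0 : 0 < B' by rewrite mulr_gt0 //; lra.
have D0 : 0 < (A + B) * (A' + B') by rewrite mulr_gt0 //; lra.
have E : A / (A + B) - A' / (A' + B')
    = 2 * (al - be) * (v * w) / ((A + B) * (A' + B')).
  by rewrite /A /B /A' /B'; field; rewrite -/A -/B -/A' -/B'; apply/andP; split; lra.
suff : (al - be) / 6 <= 2 * (al - be) * (v * w) / ((A + B) * (A' + B')) by lra.
rewrite ler_pdivlMr //.
have S : (v + w) ^+ 2 <= 9 / 2 * (v * w).
  have : 0 <= (2 * v - w) * (2 * w - v) by apply: mulr_ge0; lra.
  lra.
have AB : A + B <= 5 / 4 * (v + w) by rewrite /A /B; nra.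
have AB' : A' + B' <= 5 / 4 * (v + w) by rewrite /A' /B'; nra.
have DD : (A + B) * (A' + B') <= (5 / 4 * (v + w)) * (5 / 4 * (v + w)).
  by apply: ler_pM => //; lra.
have DD2 : (A + B) * (A' + B') <= 12 * (v * w).
  by apply: le_trans DD _; have := mulr_gt0 v0 w0; lra.
have ab0 : 0 <= (al - be) / 6 by lra.
have := ler_wpM2l ab0 DD2; lra.
Qed.

Lemma share_le (a b c d : R) : 0 < b -> 0 < d -> 0 <= a -> 0 <= c ->
  a * d <= c * b -> a / (a + b) <= c / (c + d).
Proof.
move=> b0 d0 a0 c0 h.
by rewrite ler_pdivrMr; [rewrite mulrAC ler_pdivlMr|]; nra.
Qed.

(** The threshold parameter [eta / 6] lies between [eta / 10] (close case) and [eta / 4] (far case);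
    the gaps given by [pair_share_gap] are [eta / 90] and [eta / 72], both above [eta / 100]. *)
Lemma pair_share_close eta v w x y : 0 < eta -> eta <= 1 ->
  0 < v -> 0 < w -> v <= 2 * w -> w <= 2 * v ->
  0 < y -> y <= (1 + eta / 10) * w -> (1 - eta / 10) * v <= x ->
  pair_share (eta / 6) v w <= 1 /\
  y / (x + y) <= pair_share (eta / 6) v w - eta / 100.
Proof.
move=> e0 e1 v0 w0 vw wv y0 hy hx.
have := pair_share_gap (eta / 6) (eta / 10) v w v0 w0 vw wv.
have : y / (y + x) <= pair_share (eta / 10) v w.
  have x0 : 0 < x by apply: lt_le_trans hx; rewrite mulr_gt0 //; lra.
  apply: share_le; rewrite ?mulr_ge0 ?mulr_gt0 ?(ltW y0) ?(ltW w0) //; try lra.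
  have h1 : y * (v * (1 - eta / 10)) <= y * x by rewrite ler_pM2l // mulrC.
  have h2 : y * x <= w * (1 + eta / 10) * x by rewrite ler_pM2r // mulrC.
  exact: le_trans h1 h2.
rewrite [y + x]addrC => h1 h2; split; last by have := h2; lra.
rewrite /pair_share ler_pdivrMr ?mul1r ?lerDl ?mulr_ge0 ?(ltW v0) //; first lra.
by rewrite addr_gt0 // mulr_gt0 //; lra.
Qed.

Lemma pair_share_far eta v w x y : 0 < eta -> eta <= 1 ->
  0 < v -> 0 < w -> v <= 2 * w -> w <= 2 * v ->
  0 <= x -> x <= (1 - eta / 4) * v -> (1 + eta / 4) * w <= y ->
  0 <= pair_share (eta / 6) v w /\
  x / (x + y) <= 1 - pair_share (eta / 6) v w - eta / 100.
Proof.
move=> e0 e1 v0 w0 vw wv x0 hx hy.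
have := pair_share_gap (eta / 4) (eta / 6) v w v0 w0 vw wv.
have A0 : 0 < w * (1 + eta / 4) by rewrite mulr_gt0 //; lra.
have B0 : 0 < v * (1 - eta / 4) by rewrite mulr_gt0 //; lra.
have y0 : 0 < y by apply: lt_le_trans hy; rewrite mulrC.
have : x / (x + y) <= 1 - pair_share (eta / 4) v w.
  have -> : 1 - pair_share (eta / 4) v w
     = v * (1 - eta / 4) / (v * (1 - eta / 4) + w * (1 + eta / 4)).
    by rewrite /pair_share; field; lra.
  apply: share_le; rewrite ?(ltW B0) //.
  have h1 : x * (w * (1 + eta / 4)) <= x * y by rewrite ler_wpM2l // mulrC.
  have h2 : x * y <= v * (1 - eta / 4) * y by rewrite ler_pM2r // mulrC.
  exact: le_trans h1 h2.
move=> h1 h2; split; last by have := h2; lra.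
rewrite /pair_share divr_ge0 ?addr_ge0 ?mulr_ge0 ?(ltW v0) ?(ltW w0) //; lra.
Qed.

End Threshold.

(** * The mass of discrepant pairs *)

Section DiscrepantPairs.
Context {R : realType} {n : nat} (P Q : distr R n) {I : finType}.
Variables (b : R -> I) (i0 : I) (eta : R).
Hypotheses (eta0 : 0 < eta).

Let bin (D : distr R n) i : R := \sum_(x | b (P x) == i) D x.
Let dev i : R := \sum_(x | b (P x) == i) `|P x - Q x|.

Definition low : pred (cube n) := fun x => Q x <= (1 - eta / 4) * P x.
Definition high : pred (cube n) := fun x => (1 + eta / 4) * P x <= Q x.

Let lowmass i : R := \sum_(x | (b (P x) == i) && low x) P x.
Let highmass i : R := \sum_(x | (b (P x) == i) && high x) Q x.

(** Pointwise, the left side is twice the positive part of [P x - Q x]: at most [2 * P x] at a low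
    point, and at most [eta / 2 * P x] elsewhere. [highmass_ge] is the mirror image, with [Q x]
    bounding the excess at high points. *)
Let lowmass_ge i :
  dev i + (bin P i - bin Q i) <= 2 * lowmass i + eta / 2 * bin P i.
Proof.
rewrite /dev /bin /lowmass big_mkcondr /= -sumrB -big_split /= !mulr_sumr.
rewrite -big_split /=; apply: ler_sum => x _.
have p0 := pmf_ge0 P x; have q0 := pmf_ge0 Q x.
have e0 : 0 <= eta * P x by rewrite mulr_ge0 // ltW.
rewrite /low; have [?|?] := leP (Q x) ((1 - eta / 4) * P x).
  by have [?|?] := leP (Q x) (P x); [rewrite ger0_norm|rewrite ltr0_norm]; lra.
by have [?|?] := leP (Q x) (P x); [rewrite ger0_norm|rewrite ltr0_norm]; lra.
Qed.

Let highmass_ge i :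
  dev i - (bin P i - bin Q i) <= 2 * highmass i + eta / 2 * bin P i.
Proof.
rewrite /dev /bin /highmass big_mkcondr /= -!sumrB !mulr_sumr.
rewrite -big_split /=; apply: ler_sum => x _.
have p0 := pmf_ge0 P x; have q0 := pmf_ge0 Q x.
have e0 : 0 <= eta * P x by rewrite mulr_ge0 // ltW.
rewrite /high; have [?|?] := leP ((1 + eta / 4) * P x) (Q x).
  by have [?|?] := leP (Q x) (P x); [rewrite ger0_norm|rewrite ltr0_norm]; lra.
by have [?|?] := leP (Q x) (P x); [rewrite ger0_norm|rewrite ltr0_norm]; lra.
Qed.

Let bin_sum1 D : \sum_i bin D i = 1.
Proof.
by rewrite -(pmf_sum1 D) (partition_big (fun x => b (P x)) predT).
Qed.

Let bin_ge0 D i : 0 <= bin D i.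
Proof. by apply: sumr_ge0 => x _; exact: pmf_ge0. Qed.

Let dev_sum : \sum_i dev i = 2 * dTV P Q.
Proof.
rewrite /dTV mulrA divff ?mul1r; last by rewrite pnatr_eq0.
by rewrite (partition_big (fun x => b (P x)) predT).
Qed.

Let dev_le i : dev i <= bin P i + bin Q i.
Proof.
rewrite /dev /bin -big_split /=; apply: ler_sum => x _.
by rewrite (le_trans (ler_normB _ _)) // !ger0_norm // pmf_ge0.
Qed.

Lemma discrepant_pair_mass :
  \sum_i `|bin P i - bin Q i| <= 3 / 4 * eta -> bin P i0 <= eta / 8 ->
  eta < dTV P Q ->
  eta ^+ 2 / 32 <= \sum_(i | i != i0)
    lowmass i * (highmass i * (#|I|%:R / (1 + #|I|%:R * bin Q i))).
Proof.
move=> close P0 far; set l := #|I|%:R.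
have l0 : 0 < l by rewrite ltr0n; apply/card_gt0P; exists i0.
pose z i := Num.min (lowmass i) (highmass i).
have low0 i : 0 <= lowmass i by apply: sumr_ge0 => x _; exact: pmf_ge0.
have high0 i : 0 <= highmass i by apply: sumr_ge0 => x _; exact: pmf_ge0.
have z_ge i : dev i - `|bin P i - bin Q i| - eta / 2 * bin P i <= 2 * z i.
  have h1 := lowmass_ge i; have h2 := highmass_ge i.
  have := ler_norm (bin P i - bin Q i); have := ler_norm (- (bin P i - bin Q i)).
  by rewrite normrN /z; have [_|_] := leP (lowmass i) (highmass i); lra.
(* Over all buckets the lower bounds of [z_ge] sum to more than [2 * eta - 3/4 * eta - eta / 2]; the
   term of [i0] is at most [2 * bin P i0 <= eta / 4]. What is left, [eta / 2], bounds twice the sum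
   of [z]. *)
have zsum : eta / 4 <= \sum_(i | i != i0) z i.
  have : \sum_(i | i != i0) (dev i - `|bin P i - bin Q i| - eta / 2 * bin P i)
      <= \sum_(i | i != i0) (2 * z i) by apply: ler_sum.
  rewrite -mulr_sumr.
  have : \sum_i (dev i - `|bin P i - bin Q i| - eta / 2 * bin P i)
      = 2 * dTV P Q - \sum_i `|bin P i - bin Q i| - eta / 2.
    by rewrite !sumrB -mulr_sumr bin_sum1 dev_sum mulr1.
  rewrite (bigD1 i0) //=.
  have := dev_le i0; have := ler_norm (- (bin P i0 - bin Q i0)); rewrite normrN.
  have e0 : 0 <= eta * bin P i0 by rewrite mulr_ge0 // ltW.
  lra.
(* Weighted AM-GM; the weights [1 / l + bin Q i] sum up to 2. *)
have zAG i : z i <= 4 / eta * (lowmass i * (highmass i * (l / (1 + l * bin Q i))))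
    + eta / 16 * (l^-1 + bin Q i).
  have lq : 0 < 1 + l * bin Q i by rewrite ltr_wpDr // mulr_ge0 // ltW.
  set g := l / (1 + l * bin Q i); have g0 : 0 < g by rewrite divr_gt0.
  have -> : l^-1 + bin Q i = g^-1.
    by rewrite /g invf_div mulrDl mul1r [l * _]mulrC mulfK // lt0r_neq0.
  have zz : z i ^+ 2 <= lowmass i * highmass i.
    by rewrite expr2 ler_pM // /z ?le_min ?ge_min ?lexx ?orbT ?low0 ?high0.
  apply: (@le_trans _ _ (4 / eta * (z i ^+ 2 * g) + eta / 16 * g^-1)).
    have -> : 4 / eta * (z i ^+ 2 * g) + eta / 16 * g^-1
        = z i + 4 / eta * g * (z i - eta / 8 / g) ^+ 2 by field; rewrite !lt0r_neq0.
    by rewrite lerDl mulr_ge0 ?sqr_ge0 // mulr_ge0 ?(ltW g0) // divr_ge0 ?(ltW eta0).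
  by rewrite lerD2r ler_pM2l ?divr_gt0 // mulrA ler_pM2r.
have : \sum_(i | i != i0) z i <= \sum_(i | i != i0)
    (4 / eta * (lowmass i * (highmass i * (l / (1 + l * bin Q i))))
    + eta / 16 * (l^-1 + bin Q i)) by apply: ler_sum.
rewrite big_split /= -!mulr_sumr; set S := \sum_(i | i != i0) (_ * _).
have : \sum_(i | i != i0) (l^-1 + bin Q i) <= 2.
  apply: (@le_trans _ _ (\sum_i (l^-1 + bin Q i))).
    by rewrite [leRHS](bigD1 i0) //= lerDr addr_ge0 ?bin_ge0 // invr_ge0 ltW.
  rewrite big_split /= bin_sum1 sumr_const -[_ *+ _]mulr_natr mulVf; first by lra.
  by rewrite lt0r_neq0.
move=> h1 h2.
have h3 : eta / 16 * \sum_(i | i != i0) (l^-1 + bin Q i) <= eta / 16 * 2.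
  by rewrite ler_pM2l // divr_gt0.
have h4 : eta / 8 <= 4 / eta * S by lra.
have := ler_wpM2l (ltW eta0) h4.
have -> : eta * (4 / eta * S) = 4 * S by field; rewrite lt0r_neq0.
lra.
Qed.

End DiscrepantPairs.

(** * The tester *)

Section SampleSizes.
Context {R : realType}.
Implicit Types (r eta : R).

Definition ceiln r : nat := (Num.truncn r).+1.

Lemma ceiln_ge r : r <= (ceiln r)%:R.
Proof. by rewrite ltW // truncnS_gt. Qed.

Lemma ceiln_le r : 0 <= r -> (ceiln r)%:R <= r + 1.
Proof. by move=> r0; rewrite -natr1 lerD2r truncn_le. Qed.

(** Taken for [histogram_error] with [e = eta / 2 ^+ 9]; with [nu = eta / 8], two histograms
    together fail with probability at most [1 / 32]. *)
Definition hist_size (k : nat) eta : nat := ceiln (k%:R / (eta / 2 ^+ 9) ^+ 2).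
Definition level_num (n : nat) eta : nat := (n + (ceiln (2 * ln eta^-1) + 3))%N.
Definition pair_num eta : nat := ceiln (2 ^+ 12 / eta ^+ 2).
Definition pcond_num eta : nat :=
  ceiln (8 * (20 * (1 + ln eta^-1)) / (eta / 100) ^+ 2).

Lemma ln_inv_ge0 eta : 0 < eta -> eta <= 1 -> 0 <= ln eta^-1.
Proof. by move=> e0 e1; rewrite ln_ge0 // invf_ge1. Qed.

Lemma expR_ln_inv eta : 0 < eta -> expR (- ln eta^-1) = eta.
Proof. by move=> e0; rewrite lnV ?posrE // opprK lnK ?posrE. Qed.

(** Each of the [2 ^ n] points may weigh [2^-K] in the last bucket. The summand [n] of [K] cancels
    their number, [3] gives the 8, and [2 * ln eta^-1] gives [eta] because [expR (1 / 2) <= 2]. *)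
Lemma level_num_small n eta : 0 < eta -> eta <= 1 ->
  (2 ^ n)%:R * 2^-1 ^+ level_num n eta <= eta / 8.
Proof.
move=> e0 e1; rewrite /level_num !exprD natrX mulrA -exprMn divff ?pnatr_eq0 //.
rewrite expr1n mul1r (_ : 2^-1 ^+ 3 = 8^-1) ?ler_pM2r ?invr_gt0 //; last by field.
set c := ceiln _.
have h2 : expR (1 / 2) <= 2 :> R.
  by apply: le_trans (expR_le_quadratic _ _) _; lra.
have h3 : (expR (1 / 2) ^+ c)^-1 >= 2^-1 ^+ c :> R.
  rewrite exprVn lef_pV2 ?posrE ?exprn_gt0 ?expR_gt0 //.
  by rewrite lerXn2r ?nnegrE ?expR_ge0.
apply: le_trans h3 _; rewrite -expRM_natl -expRN -[leRHS]expR_ln_inv // ler_expR.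
rewrite lerN2; have := ceiln_ge (2 * ln eta^-1); rewrite -/c; lra.
Qed.

Lemma hist_size_ge k eta : 0 < eta ->
  k%:R <= (hist_size k eta)%:R * (eta / 2 ^+ 9) ^+ 2.
Proof.
move=> e0; rewrite -ler_pdivrMr; first exact: ceiln_ge.
by rewrite exprn_gt0 // divr_gt0 // exprn_gt0.
Qed.

Lemma pair_num_le eta : 0 < eta -> eta <= 1 ->
  (pair_num eta)%:R <= 2 ^+ 13 / eta ^+ 2.
Proof.
move=> e0 e1; have q0 : 0 < eta ^+ 2 by rewrite exprn_gt0.
have le1 : 1 <= (eta ^+ 2)^-1 by rewrite invf_ge1 // exprn_ile1 // ltW.
apply: le_trans (ceiln_le _ _) _; last by lra.
by rewrite divr_ge0 // ?exprn_ge0 // ltW.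
Qed.

Definition pcond_err eta : R :=
  expR (- ((pcond_num eta)%:R * (eta / 100) ^+ 2 / 8)).

(** The factor [eta ^+ 2] pays for the union bound over the [O(1 / eta^2)] pairs of a run. *)
Lemma pcond_err_le eta : 0 < eta -> eta <= 1 ->
  pcond_err eta <= 2^-1 ^+ 20 * eta ^+ 2.
Proof.
move=> e0 e1; have l0 := ln_inv_ge0 _ e0 e1; set l := ln _ in l0.
have q0 : 0 < (eta / 100) ^+ 2 by rewrite exprn_gt0 // divr_gt0.
apply: (@le_trans _ _ (expR (- (20 * (1 + l))))).
  rewrite ler_expR lerN2 ler_pdivlMr // mulrC -ler_pdivrMr //.
  exact: ceiln_ge.
have -> : - (20 * (1 + l)) = 20%:R * (- 1) + 2%:R * (- l) + 18%:R * (- l) by ring.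
rewrite !expRD !expRM_natl expR_ln_inv //.
have h1 : expR (- 1) <= 2^-1 :> R.
  rewrite expRN lef_pV2 ?posrE ?expR_gt0 //.
  by have := expR_ge1Dx (1 : R); lra.
apply: (@le_trans _ _ (expR (- 1) ^+ 20 * eta ^+ 2)).
  apply: ler_piMr; last by rewrite exprn_ile1 // ltW.
  by rewrite mulr_ge0 ?exprn_ge0 ?expR_ge0 ?(ltW e0).
by rewrite ler_pM2r ?exprn_gt0 // lerXn2r ?nnegrE ?expR_ge0 // invr_ge0.
Qed.

End SampleSizes.

(* For [n = 1] the second stage must be skipped: there [ln n = 0] and the query
   bound is only [1 / eta ^+ 2], but binning by the point itself is affordable. *)
Definition tester {R : realType} (n : nat) (eta : R) : prog R n bool :=
  if (n <= 1)%N then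
    histogram_test (fun x _ => x) (hist_size #|cube n| eta) (eta / 2)
  else
    let K := level_num n eta in
    bind (histogram_test (fun _ v => level K v) (hist_size K.+1 eta) (eta / 2))
      (fun r => if r then Ret true else
        any_of (pair_num eta)
          (bucket_pair_test (level K) ord_max K.+1 (pcond_num eta)
             (pair_share (eta / 6)))).

Definition tester_cost {R : realType} (n : nat) (eta : R) : nat :=
  if (n <= 1)%N then (hist_size #|cube n| eta * 4)%N
  else
    let K := level_num n eta in
    (hist_size K.+1 eta * 4
     + pair_num eta * (2 + (K.+1 * 2 + pcond_num eta)))%N.

(** * Error probability of a single run *)

Section Tester.
Context {R : realType} {n : nat} {P Q : distr R n} (eta : R).
Hypotheses (eta0 : 0 < eta) (eta1 : eta <= 1).
Local Notation Ex := (expect P Q).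
Local Notation ok := (valid P Q).

Lemma ok_tester : ok (tester n eta) (tester_cost n eta) (fun=> True).
Proof.
rewrite /tester /tester_cost; case: ifP => _; first exact: ok_histogram_test.
apply: ok_bind (ok_histogram_test _ _ _) _ => -[] _ //.
exact: ok_any_of (ok_bucket_pair_test _ _ _ _ _).
Qed.

Let e0 : 0 < eta / 2 ^+ 9.
Proof. by rewrite divr_gt0 // exprn_gt0. Qed.

Let nu0 : 0 < eta / 8.
Proof. by rewrite divr_gt0. Qed.

Let errE : 2 * (eta / 2 ^+ 9) / (eta / 8) = 1 / 32.
Proof. by field; rewrite lt0r_neq0. Qed.

Lemma bin_dist_le {I : finType} (b : cube n -> R -> I) :
  \sum_i `|@bin_mass R n P I b P i - @bin_mass R n P I b Q i|
    <= \sum_x `|P x - Q x|.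
Proof.
rewrite [leRHS](partition_big (fun x => b x (P x)) predT) //=.
by apply: ler_sum => i _; rewrite /bin_mass -sumrB ler_norm_sum.
Qed.

Lemma pmf_le1 (D : distr R n) x : D x <= 1.
Proof.
rewrite -(pmf_sum1 D) (bigD1 x) //= lerDl.
by apply: sumr_ge0 => y _; exact: pmf_ge0.
Qed.

Let K := level_num n eta.
Let pair_tester : prog R n bool :=
  bucket_pair_test (level K) ord_max K.+1 (pcond_num eta) (pair_share (eta / 6)).

Let d0 : 0 <= eta / 100. Proof. by rewrite divr_ge0 // ltW. Qed.
Let d2 : eta / 100 <= 2. Proof. by have h1 := eta1; lra. Qed.

Lemma tester_close :
  (forall x, (1 - eta / 10) * P x <= Q x /\ Q x <= (1 + eta / 10) * P x) ->
  Ex (tester n eta) (fun r => (r != false)%:R) <= 1 / 16.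
Proof.
have h0 := eta0; have h1 := eta1.
move=> close; under [X in Ex _ X]funext => r do rewrite eqbF_neg negbK.
(* Below [eta / 4], which is the threshold [eta / 2] less the allowance [2 * nu] for sampling
   error. *)
have dist : \sum_x `|P x - Q x| <= eta / 10.
  have -> : eta / 10 = \sum_x eta / 10 * P x by rewrite -mulr_sumr pmf_sum1 mulr1.
  apply: ler_sum => x _.
  by have [? ?] := close x; rewrite ler_norml; apply/andP; split; lra.
have hist (I : finType) (b : cube n -> R -> I) : (0 < #|I|)%N ->
    Ex (histogram_test b (hist_size #|I| eta) (eta / 2)) (fun r => r%:R) <= 1 / 32.
  move=> I0; rewrite -errE; apply: histogram_test_close => //.
    exact: hist_size_ge.
  by apply: le_trans (bin_dist_le _) _; lra.
rewrite /tester; case: ifP => _.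
  apply: le_trans (hist _ _ _) _; last by lra.
  by rewrite card_tuple card_bool expn_gt0.
rewrite -/K -/pair_tester Ex_bind.
have okh := ok_histogram_test (P := P) (Q := Q) (fun _ v => level K v)
  (hist_size K.+1 eta) (eta / 2).
have okp := ok_bucket_pair_test (P := P) (Q := Q) (level K) ord_max K.+1
  (pcond_num eta) (pair_share (eta / 6)).
have oka := ok_any_of _ _ (pair_num eta) okp.
have any : Ex (any_of (pair_num eta) pair_tester) (fun r => r%:R) <= 1 / 32.
  apply: le_trans (Ex_any_of_true (ok_bucket_pair_test _ _ _ _ _) _) _.
  have hp : Ex pair_tester (fun r => r%:R) <= pcond_err eta.
    apply: bucket_pair_test_close => // x y Px Qy xy lxy lx.
    have ly : level K (P y) != ord_max by rewrite lxy.
    have [? ?] := close x; have [? ?] := close y.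
    apply: pair_share_close => //; try exact: (level_gt0 _ _ ly).
      exact: (level_ratio K _ _ (pmf_le1 _ _)).
    exact: (level_ratio K _ _ (pmf_le1 _ _)).
  have q0 : 0 < eta ^+ 2 by rewrite exprn_gt0.
  apply: (@le_trans _ _ (2 ^+ 13 / eta ^+ 2 * (2^-1 ^+ 20 * eta ^+ 2))).
    apply: ler_pM => //; last by rewrite (le_trans hp) // pcond_err_le.
      by apply: (Ex_ge0 (ok_bucket_pair_test _ _ _ _ _)) => r _; exact: ler0n.
    exact: pair_num_le.
  have -> : 2 ^+ 13 / eta ^+ 2 * (2^-1 ^+ 20 * eta ^+ 2) = 2^-1 ^+ 7.
    by field; rewrite lt0r_neq0.
  by lra.
apply: (@le_trans _ _ (1 / 32 + 1 / 32)); last by lra.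
have := hist _ (fun _ v => level K v); rewrite card_ord => /(_ isT) h.
apply: le_trans (lerD h any); rewrite -[X in _ + X](Ex_cst okh) -ExD.
apply: (ler_Ex okh) => -[] _ /=; last by rewrite add0r.
by rewrite lerDl; apply: (Ex_ge0 oka) => r _; exact: ler0n.
Qed.

Lemma tester_far : eta < dTV P Q ->
  Ex (tester n eta) (fun r => (r != true)%:R) <= 1 / 16.
Proof.
have h0 := eta0; have h1 := eta1.
move=> far; under [X in Ex _ X]funext => r do rewrite eqb_id.
have hist (I : finType) (b : cube n -> R -> I) : (0 < #|I|)%N ->
    3 / 4 * eta
      < \sum_i `|@bin_mass R n P I b P i - @bin_mass R n P I b Q i| ->
    Ex (histogram_test b (hist_size #|I| eta) (eta / 2)) (fun r => (~~ r)%:R)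
      <= 1 / 32.
  move=> I0 fari; rewrite -errE; apply: histogram_test_far => //.
    exact: hist_size_ge.
  by apply: le_lt_trans fari; lra.
rewrite /tester; case: ifP => _.
  apply: le_trans (hist _ _ _ _) _; last by lra.
    by rewrite card_tuple card_bool expn_gt0.
  have -> : \sum_i `|@bin_mass R n P _ (fun x _ => x) P i
      - @bin_mass R n P _ (fun x _ => x) Q i| = 2 * dTV P Q.
    rewrite /dTV mulrA divff ?mul1r; last by rewrite pnatr_eq0.
    by apply: eq_bigr => x _; rewrite /bin_mass !big_pred1_eq.
  by lra.
rewrite -/K -/pair_tester Ex_bind.
have okh := ok_histogram_test (P := P) (Q := Q) (fun _ v => level K v)
  (hist_size K.+1 eta) (eta / 2).
have okp := ok_bucket_pair_test (P := P) (Q := Q) (level K) ord_max K.+1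
  (pcond_num eta) (pair_share (eta / 6)).
have oka := ok_any_of _ _ (pair_num eta) okp.
set dist := \sum_i `|@bin_mass R n P _ (fun _ v => level K v) P i
      - @bin_mass R n P _ (fun _ v => level K v) Q i|.
(* [3 / 4 * eta] is the threshold [eta / 2] plus [2 * nu]: above it the histograms reject, below it
   discrepant pairs are frequent. *)
have [close|fari] := leP dist (3 / 4 * eta); last first.
  have := hist _ (fun _ v => level K v); rewrite card_ord => /(_ isT fari) h.
  apply: (@le_trans _ _ (1 / 32)); last by lra.
  apply: le_trans h; apply: (ler_Ex okh) => -[] _ //=.
  by apply: (Ex_le oka) => -[].
apply: (Ex_le okh) => -[] _; first by rewrite /=; lra.
rewrite -[X in Ex X _]/(any_of (pair_num eta) pair_tester).
rewrite Ex_any_of_false.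
have last_mass : @bin_mass R n P _ (fun _ v => level K v) P ord_max <= eta / 8.
  apply: le_trans (level_num_small n _ eta0 eta1).
  have cardE : #|cube n| = (2 ^ n)%N by rewrite card_tuple card_bool.
  rewrite mulr_natl -cardE -sumr_const /bin_mass big_mkcond /=.
  apply: ler_sum => x _; case: eqP => [lx|_].
    by have := level_le K (P x) (pmf_le1 _ _); rewrite lx.
  by rewrite exprn_ge0 // invr_ge0.
have mass_ge := discrepant_pair_mass P Q (level K) ord_max eta eta0
  close last_mass far.
rewrite card_ord in mass_ge.
have hit := bucket_pair_test_far (P := P) (Q := Q) (level K) ord_max K.+1
  (pcond_num eta) (pair_share (eta / 6)) _ d0 d2 (low P Q eta) (high P Q eta).
have q0 : 0 < eta ^+ 2 by rewrite exprn_gt0.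
have err2 : pcond_err eta <= 1 / 2.
  apply: le_trans (pcond_err_le _ eta0 eta1) _.
  have : eta ^+ 2 <= 1 by rewrite exprn_ile1 // ltW.
  by lra.
have hp : Ex pair_tester (fun r => (~~ r)%:R) <= 1 - eta ^+ 2 / 64.
  have := Ex_compl okp id; rewrite -/pair_tester => E.
  suff : eta ^+ 2 / 64 <= Ex pair_tester (fun r => r%:R) by lra.
  apply: le_trans (hit _); last first.
    move=> x y lx hy Px Qy lxy lm; have ly : level K (P y) != ord_max by rewrite lxy.
    have [? ?] : 0 <= pair_share (eta / 6) (P x) (P y) /\
      Q x / (Q x + Q y) <= 1 - pair_share (eta / 6) (P x) (P y) - eta / 100.
      apply: pair_share_far => //; try exact: (level_gt0 _ _ ly).
      - exact: (level_ratio K _ _ (pmf_le1 _ _)).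
      - exact: (level_ratio K _ _ (pmf_le1 _ _)).
      - exact: pmf_ge0.
    (* A point of positive [P]-mass cannot be both low and high. *)
    split=> //; apply: contraTneq lx => ->; rewrite /low -ltNge.
    apply: lt_le_trans hy; have Py := level_gt0 _ _ ly.
    by rewrite ltr_pM2r //; lra.
  rewrite -/(pcond_err eta).
  have -> : eta ^+ 2 / 64 = 1 / 2 * (eta ^+ 2 / 32) by field.
  apply: ler_pM => //; lra.
(* Each pair is caught with probability at least [eta ^+ 2 / 64], and [pair_num] times this is at
   least 64, so all pairs fail with probability at most [1 / 65]. *)
have := expr_le_inv _ _ (pair_num eta) (Ex_ge0 okp _ _) _ hp.
move=> /(_ _ _)/le_trans; apply.
- by move=> r _; exact: ler0n.
- lra.
apply: (@le_trans _ _ (1 + 64)^-1); last first.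
  by rewrite div1r lef_pV2 ?posrE; lra.
rewrite lef_pV2 ?posrE; [|by rewrite ltr_wpDr // mulr_ge0 //; lra|by lra].
rewrite lerD2l mulrA ler_pdivlMr //.
have := ceiln_ge (2 ^+ 12 / eta ^+ 2); rewrite ler_pdivrMr // -/(pair_num eta).
lra.
Qed.

End Tester.

(** * Query complexity *)

Lemma dinf_le {R : realType} {n : nat} (P Q : distr R n) (eps : R) x :
  (dinf P Q <= eps%:E)%E ->
  (1 - eps) * P x <= Q x /\ Q x <= (1 + eps) * P x.
Proof.
move/(le_trans (le_bigmax _ (ratio_dev P Q) x)); rewrite /ratio_dev.
(* Where [P x = 0], a finite distance forces [Q x = 0]. *)
case: eqVneq => [->|Px0]; first by case: eqVneq => [->|]; rewrite ?mulr0.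
have Px : 0 < P x by rewrite lt_neqAle eq_sym Px0 pmf_ge0.
rewrite lee_fin ler_norml => /andP[h1 h2].
have h3 : 1 - eps <= Q x / P x by lra.
have h4 : Q x / P x <= 1 + eps by lra.
by rewrite ler_pdivlMr // in h3; rewrite ler_pdivrMr // in h4.
Qed.

Section QueryCount.
Context {R : realType}.
Implicit Types (n : nat) (eta eps delta : R).

Let logs eta : R := 1 + ln eta^-1.

Lemma hist_size_le n k eta (L : R) : 0 < eta -> eta <= 1 -> 1 <= L ->
  (1 <= n)%N -> k%:R <= 6 * n%:R * L ->
  (hist_size k eta)%:R <= 2 ^+ 21 * L * (n%:R / eta ^+ 2).
Proof.
move=> e0 e1 L1 n1 kn; have q0 : 0 < eta ^+ 2 by rewrite exprn_gt0.
have n1' : 1 <= n%:R :> R by rewrite ler1n.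
have nL : 1 <= n%:R * L by rewrite -[leLHS]mulr1 ler_pM.
have le1 : 1 <= (eta ^+ 2)^-1 by rewrite invf_ge1 // exprn_ile1 // ltW.
apply: le_trans (ceiln_le _ _) _.
  by rewrite divr_ge0 // exprn_ge0 // divr_ge0 ?exprn_ge0 // ltW.
have -> : k%:R / (eta / 2 ^+ 9) ^+ 2 = 2 ^+ 18 * k%:R * (eta ^+ 2)^-1.
  by field; rewrite lt0r_neq0.
have h1 : k%:R * (eta ^+ 2)^-1 <= 6 * n%:R * L * (eta ^+ 2)^-1.
  by rewrite ler_pM2r ?invr_gt0.
have h2 : 1 <= n%:R * L * (eta ^+ 2)^-1 by rewrite -[leLHS]mulr1 ler_pM.
have -> : 2 ^+ 21 * L * (n%:R / eta ^+ 2) = 2 ^+ 21 * (n%:R * L * (eta ^+ 2)^-1).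
  by ring.
lra.
Qed.

Lemma level_num_le n eta : 0 < eta -> eta <= 1 -> (1 <= n)%N ->
  (level_num n eta).+1%:R <= 6 * n%:R * logs eta.
Proof.
move=> e0 e1 n1; have l0 := ln_inv_ge0 _ e0 e1.
have n1' : 1 <= n%:R :> R by rewrite ler1n.
have nl : ln eta^-1 <= n%:R * ln eta^-1 by rewrite ler_peMl.
have l2 : 0 <= 2 * ln eta^-1 by lra.
have -> : (level_num n eta).+1%:R
    = n%:R + ((ceiln (2 * ln eta^-1))%:R + 3) + 1 :> R.
  by rewrite -[LHS]natr1 /level_num !natrD.
have := ceiln_le _ l2; rewrite /logs; lra.
Qed.

Lemma pcond_num_le eta : 0 < eta -> eta <= 1 ->
  (pcond_num eta)%:R <= 2 ^+ 21 * logs eta / eta ^+ 2.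
Proof.
move=> e0 e1; have l0 := ln_inv_ge0 _ e0 e1.
have q0 : 0 < eta ^+ 2 by rewrite exprn_gt0.
have le1 : 1 <= (eta ^+ 2)^-1 by rewrite invf_ge1 // exprn_ile1 // ltW.
have L1 : 1 <= logs eta by rewrite /logs; lra.
apply: le_trans (ceiln_le _ _) _.
  rewrite divr_ge0 // ?exprn_ge0 ?divr_ge0 ?(ltW e0) //; lra.
rewrite -/(logs eta).
have -> : 8 * (20 * logs eta) / (eta / 100) ^+ 2
    = 160 * (100 * 100) * (logs eta / eta ^+ 2) by field; rewrite lt0r_neq0.
have h2 : 1 <= logs eta / eta ^+ 2 by rewrite -[leLHS]mulr1 ler_pM.
lra.
Qed.

(** Histograms and bucket searches cost [O(n / eta^2)] up to the logarithm. The PCOND queries, of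
    order [1 / eta^4], are charged to the first term of the bound: [eta - 116 / 10 * eps <= eta],
    and [Num.sqrt n * ln n] is at least [1 / 2] for [n >= 2]. *)
Lemma tester_cost_le n eta eps : 0 < eta -> eta <= 1 -> (1 <= n)%N ->
  0 <= eps -> eps < eta / (116 / 10) ->
  (tester_cost n eta)%:R <= 2 ^+ 36 * logs eta * query_bound n eta eps.
Proof.
move=> e0 e1 n1 ep0 ep1; have l0 := ln_inv_ge0 _ e0 e1.
have q0 : 0 < eta ^+ 2 by rewrite exprn_gt0.
have L1 : 1 <= logs eta by rewrite /logs; lra.
have n1' : 1 <= n%:R :> R by rewrite ler1n.
have g0 : 0 < eta - 116 / 10 * eps.
  by move: ep1; rewrite ltr_pdivlMr; lra.
set X := n%:R / eta ^+ 2.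
have X0 : 0 <= logs eta * X by rewrite mulr_ge0 ?divr_ge0 ?(ltW q0) //; lra.
have D0 : 0 < eta ^+ 3 * (eta - 116 / 10 * eps) by rewrite mulr_gt0 // exprn_gt0.
set Y := Num.sqrt n%:R * ln n%:R / (eta ^+ 3 * (eta - 116 / 10 * eps)).
have Y0 : 0 <= logs eta * Y.
  by rewrite mulr_ge0 ?divr_ge0 ?mulr_ge0 ?sqrtr_ge0 ?ln_ge0 ?(ltW D0) //; lra.
rewrite /query_bound -/X -/Y /tester_cost; case: leqP => n2.
  have k6 : #|cube n|%:R <= 6 * n%:R * logs eta.
    have -> : n = 1%N by apply/eqP; rewrite eqn_leq n1 n2.
    by rewrite card_tuple card_bool expn1; lra.
  have := hist_size_le n _ _ _ e0 e1 L1 n1 k6; rewrite -/X natrM; lra.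
have kL := level_num_le n eta e0 e1 n1; set k := (level_num n eta).+1 in kL *.
have k1 : 1 <= k%:R :> R by rewrite ler1n.
have hS := hist_size_le n _ _ _ e0 e1 L1 n1 kL; rewrite -/X in hS.
have hM := pair_num_le _ e0 e1; have hm := pcond_num_le _ e0 e1.
have M0 : 0 <= (pair_num eta)%:R :> R by [].
have h1 : (pair_num eta)%:R * (2 + k%:R * 2) <= 2 ^+ 13 * 24 * (logs eta * X).
  apply: le_trans (ler_pM M0 _ hM (_ : _ <= 24 * n%:R * logs eta)) _; [lra|lra|].
  by rewrite /X le_eqVlt; apply/orP; left; apply/eqP; field; rewrite lt0r_neq0.
have h2 : (pair_num eta)%:R * (pcond_num eta)%:R
    <= 2 ^+ 34 * (logs eta * (eta ^+ 4)^-1).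
  apply: le_trans (ler_pM M0 (ler0n _ _) hM hm) _.
  by rewrite le_eqVlt; apply/orP; left; apply/eqP; field; rewrite lt0r_neq0.
have h3 : (eta ^+ 4)^-1 <= 2 * Y.
  have s1 : 1 <= Num.sqrt n%:R :> R by rewrite -[leLHS]sqrtr1 ler_wsqrtr.
  have l2 : 1 / 2 <= ln n%:R :> R.
    apply: (@le_trans _ _ (ln 2)); last by rewrite ler_ln ?posrE ?ler_nat ?ltr0n.
    rewrite -[leLHS]expRK ler_ln ?posrE ?expR_gt0 //.
    by apply: le_trans (expR_le_quadratic _ _) _; lra.
  have sl : 1 <= 2 * (Num.sqrt n%:R * ln n%:R) :> R.
    have : 1 * (1 / 2) <= Num.sqrt n%:R * ln n%:R :> R by apply: ler_pM => //; lra.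
    lra.
  rewrite /Y mulrA ler_pdivlMr // mulrC; apply: le_trans sl.
  rewrite ler_pdivrMr ?exprn_gt0 // mul1r [eta ^+ 4]exprSr ler_pM2l ?exprn_gt0 //.
  lra.
have h4 : logs eta * (eta ^+ 4)^-1 <= logs eta * (2 * Y) by rewrite ler_pM2l //; lra.
rewrite natrD !natrM !natrD !natrM.
have -> : (pair_num eta)%:R * (2 + (k%:R * 2 + (pcond_num eta)%:R))
    = (pair_num eta)%:R * (2 + k%:R * 2)
      + (pair_num eta)%:R * (pcond_num eta)%:R :> R by ring.
lra.
Qed.

End QueryCount.

(** * Amplification of the confidence and total query count *)

Theorem theorem1 (R : realType) :
  exists (Barbarik3 : forall n : nat, R -> R -> R -> algo R n) (C : R) (c : nat),
    0 < C /\
    forall (n : nat) (eta eps delta : R),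
      (1 <= n)%N ->
      0 < eta -> eta <= 1 ->
      0 <= eps -> eps < eta / (116 / 10) ->
      0 < delta -> delta <= 1 / 2 ->
      forall P Q : distr R n,
        let A := Barbarik3 n eta eps delta in
        [/\ legal P Q A,
            (dinf P Q <= eps%:E)%E -> 1 - delta <= prob_returns P Q Accept A,
            eta < dTV P Q -> 1 - delta <= prob_returns P Q Reject A
          & (queries P Q A)%:R
              <= C * polylog c eps eta delta * query_bound n eta eps].
Proof.
(* Of the two logarithmic factors, one comes from the number of runs and one from the cost of a run;
   [2 ^+ 42] is [64 * 2 ^+ 36]. *)
exists (fun n eta _ delta =>
  compile (majority (ceiln (64 * ln delta^-1)) (tester n eta))), (2 ^+ 42), 2%N.
split; first by rewrite exprn_gt0.
move=> n eta eps delta n1 e0 e1 ep0 ep1 d0 d2 P Q A.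
have okt := ok_tester (P := P) (Q := Q) eta.
have okm := ok_majority _ _ (ceiln (64 * ln delta^-1)) okt.
have err : expR (- ((ceiln (64 * ln delta^-1))%:R / 64)) <= delta.
  rewrite -[leRHS]expR_ln_inv // ler_expR lerN2.
  have := ceiln_ge (64 * ln delta^-1); lra.
have d1 : delta <= 1 by lra.
split.
- exact: legal_compile okm.
- move=> close; rewrite prob_compile (Ex_compl okm) lerD2l lerN2.
  apply: le_trans err; apply: (majority_error okt _ false).
  apply: tester_close => // x; have [h1 h2] := dinf_le _ _ _ x close.
  have p0 := pmf_ge0 P x.
  (* [eps < eta / 11.6] lies within the tolerance [eta / 10] of [tester_close]. *)
  have : eps * P x <= eta / 10 * P x by rewrite ler_wpM2r //; lra.
  by move=> h; split; lra.
- move=> far; rewrite prob_compile (Ex_compl okm) lerD2l lerN2.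
  apply: le_trans err; apply: (majority_error okt _ true).
  exact: tester_far.
have := queries_compile _ _ _ okm; rewrite -(ler_nat R) => /le_trans; apply.
have l0 := ln_inv_ge0 _ e0 e1; have ld0 := ln_inv_ge0 _ d0 d1.
have le0 : 0 <= ln eps^-1.
  (* For [eps = 0] the conventions [0^-1 = 0] and [ln 0 = 0] apply. *)
  have [->|epn] := eqVneq eps 0; first by rewrite invr0 ln0.
  by rewrite ln_inv_ge0 // ?lt_neqAle 1?eq_sym ?epn //; lra.
have ld64 : 0 <= 64 * ln delta^-1 by lra.
have hr := ceiln_le _ ld64.
have ht := tester_cost_le n eta eps e0 e1 n1 ep0 ep1.
have B0 : 0 <= query_bound n eta eps.
  have g0 : 0 < eta - 116 / 10 * eps by move: ep1; rewrite ltr_pdivlMr; lra.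
  by rewrite /query_bound addr_ge0 ?divr_ge0 ?mulr_ge0 ?sqrtr_ge0 ?ln_ge0 ?exprn_ge0
    ?ler1n ?(ltW e0) ?(ltW g0) //.
rewrite natrM /polylog; set L := 1 + ln eps^-1 + ln eta^-1 + ln delta^-1.
have -> : 2 ^+ 42 * L ^+ 2 * query_bound n eta eps
    = (64 * L) * (2 ^+ 36 * L * query_bound n eta eps) by ring.
apply: ler_pM => //; first by rewrite /L; lra.
apply: le_trans ht _; rewrite ler_wpM2r // ler_wpM2l ?exprn_ge0 //.
by rewrite /L; lra.
Qed.
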